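(* Let $M$ be a compact Alexandrov space with curvature $\ge\kappa$ (for some $\kappa\in\mathbb R$) and radius $R$. If $\mathrm{ob}(M)=\pi/2$, then $1\text{-}\mathrm{inj}(M)\ge R/2$.
   Context: Alexandrov spaces of curvature $\ge\kappa$ are taken in the sense of Burago–Gromov–Perelman and are assumed finite-dimensional. $|x,y|$ denotes distance. A minimal geodesic is an isometric embedding of an interval. For a point $p$, $\Sigma_p$ is the space of directions at $p$ with its angle metric $\angle$. For $p\ne q$, $\Uparrow_p^q\subset\Sigma_p$ is the set of all directions at $p$ of minimal geodesics from $p$ to $q$, and $\uparrow_p^q$ denotes an element of $\Uparrow_p^q$. For a set $A\subset \Sigma_p$, $\angle(A,\xi)$ is the distance in $\Sigma_p$ from $\xi$ to $A$. For compact $M$ the radius is $R=\mathrm{rad}(M)=\inf_{p\in M}\sup_{q\in M}|p,q|$. With $B(p,r)$ the open ball, for $p\ne q\in M$ define $$\mathrm{ob}(p;q)=\sup_{x\in B(p,R/2)^c}\angle(\Uparrow_p^q,\uparrow_p^x)-\pi/2$$ (supremum over all $x\in M$ with $|p,x|\ge R/2$ and all $\uparrow_p^x\in\Uparrow_p^x$), $\mathrm{ob}(p,q)=\max\{\mathrm{ob}(p;q),\mathrm{ob}(q;p)\}$, and the obtuse constant $\mathrm{ob}(M)=\liminf_{|p,q|\to0}\mathrm{ob}(p,q)\in[0,\pi/2]$, over pairs $p\neq q$ in $M$. For $\xi\in\Sigma_p$, the opposite direction $-\xi$, if it exists, is the element of $\Sigma_p$ with $\angle(\xi,-\xi)=\pi$.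 The one-side injectivity radius $1\text{-}\mathrm{inj}(M)$ is the supremum of those $r\ge0$ such that for every $p\in M$ and every $\xi\in\Sigma_p$ there exists a minimal geodesic of length $\ge r$ starting from $p$ in the direction of at least one of $\xi$ or $-\xi$ (the latter if it exists). *)

(* Defs.v *)
From mathcomp Require Import all_boot all_order all_algebra.
From mathcomp Require Import all_classical all_reals all_analysis.
From mathcomp Require Import ring.

Set Implicit Arguments.
Unset Strict Implicit.
Unset Printing Implicit Defensive.

Import Order.TTheory GRing.Theory Num.Theory.
Import numFieldNormedType.Exports.

Local Open Scope classical_set_scope.
Local Open Scope ring_scope.

Section comparison.
Context {R : realType}.
Implicit Types k x a b c : R.

Definition cosh x : R := (expR x + expR (- x)) / 2.
Definition sinh x : R := (expR x - expR (- x)) / 2.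

(* In the simply connected surface of constant curvature k: the angle between
   the sides of lengths a and b of a triangle whose third side has length c
   (laws of cosines). It is meaningful when a and b are positive, the three
   lengths satisfy the triangle inequalities and, for k > 0, the perimeter is
   less than 2 pi / sqrt k; it is only evaluated on small triangles. *)
Definition cangle k a b c : R :=
  if k == 0 then acos ((a ^+ 2 + b ^+ 2 - c ^+ 2) / (2 * a * b))
  else let w := Num.sqrt `|k| in
  if 0 < k then
    acos ((cos (w * c) - cos (w * a) * cos (w * b))
          / (sin (w * a) * sin (w * b)))
  else
    acos ((cosh (w * a) * cosh (w * b) - cosh (w * c))
          / (sinh (w * a) * sinh (w * b))).

End comparison.

Section hausdorff_dimension.
Context {R : realType} {M : metricType R}.
Local Open Scope ereal_scope.

Definition ediam (A : set M) : \bar R :=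
  ereal_sup (0 |` [set (mdist xy.1 xy.2)%:E | xy in A `*` A]).

Definition hausdorff_content (s d : R) (A : set M) : \bar R :=
  ereal_inf [set \sum_(0 <= n <oo) (ediam (U n) `^ s) |
             U in [set U : nat -> set M |
                   A `<=` \bigcup_n U n /\ forall n, ediam (U n) <= d%:E]].

Definition hausdorff_measure (s : R) (A : set M) : \bar R :=
  ereal_sup [set hausdorff_content s d A | d in [set d : R | (0 < d)%R]].

(* Exponents s > 0 are enough, and this avoids the convention for 0 to the
   power 0. *)
Definition hausdorff_dim (A : set M) : \bar R :=
  ereal_inf [set s%:E | s in [set s : R | (0 < s)%R /\
                                          hausdorff_measure s A = 0]].

End hausdorff_dimension.

Section alexandrov.
Context {R : realType}.

(* Burago-Gromov-Perelman, 2.1: chains of arbitrarily small steps whose total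
   length is arbitrarily close to the distance. *)
Definition intrinsic_metric (M : metricType R) : Prop :=
  forall (x y : M) (d : R), 0 < d -> exists (n : nat) (z : nat -> M),
    [/\ z 0%N = x, z n = y,
        forall i, (i < n)%N -> mdist (z i) (z i.+1) < d
      & \sum_(i < n) mdist (z i) (z i.+1) < mdist x y + d].

Definition locally_complete (M : metricType R) : Prop :=
  forall x : M, exists2 r : R, 0 < r &
    forall u : nat -> M, (forall n, mdist x (u n) <= r) ->
      cauchy (u @ \oo) -> exists y : M, u @ \oo --> y.

Definition four_point_condition (k : R) (M : metricType R) (U : set M) : Prop :=
  forall a b c d : M, U a -> U b -> U c -> U d -> uniq [:: a; b; c; d] ->
    cangle k (mdist a b) (mdist a c) (mdist b c)
    + cangle k (mdist a c) (mdist a d) (mdist c d)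
    + cangle k (mdist a d) (mdist a b) (mdist d b) <= 2 * pi.

(* The last field is the usual extra convention in dimension one, where the
   four point condition does not bound the diameter. *)
Record alexandrov (k : R) (M : metricType R) : Prop := {
  alexandrov_neq0 : [set: M] !=set0;
  alexandrov_complete : locally_complete M;
  alexandrov_intrinsic : intrinsic_metric M;
  alexandrov_findim : (hausdorff_dim [set: M] < +oo)%E;
  alexandrov_curv : forall x : M,
    exists2 U : set M, nbhs x U & four_point_condition k U;
  alexandrov_dim1 : 0 < k -> hausdorff_dim [set: M] = 1%:E ->
    forall x y : M, mdist x y <= pi / Num.sqrt k
}.

End alexandrov.

Section directions.
Context {R : realType} {M : metricType R}.

(* Nondegenerate minimal geodesics starting from p; only the values of gpath
   on [0, glen] are relevant. *)
Record geodesic (p : M) := Geodesic {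
  glen : R;
  gpath :> R -> M;
  glen_gt0 : 0 < glen;
  gpath0 : gpath 0 = p;
  gpath_isom : forall s t : R, 0 <= s <= glen -> 0 <= t <= glen ->
    mdist (gpath s) (gpath t) = `|s - t|
}.

Section at_point.
Context {p : M}.

Definition gangle (g h : geodesic p) : R :=
  lim (cangle 0 st.1 st.2 (mdist (g st.1) (h st.2)) @[st --> (0^'+, 0^'+)]).

Lemma gangle_refl (g : geodesic p) : gangle g g = 0.
Proof.
have g0 := glen_gt0 g.
pose F := filter_prod (0 : R)^'+ (0 : R)^'+.
have FF : ProperFilter F by exact: filter_prod_proper.
apply: (@cvg_lim R _ _ F FF); first exact: Rhausdorff.
have near_pos : \forall s \near (0 : R)^'+, 0 < s <= glen g.
  near=> s; apply/andP; split; near: s; first exact: nbhs_right_gt.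
  exact: nbhs_right_le.
apply: cvg_near_cst.
exists ([set s | 0 < s <= glen g], [set s | 0 < s <= glen g]) => //.
move=> [s t] /= [/andP[s0 sl] /andP[t0 tl]].
have -> : mdist (g s) (g t) = `|s - t|.
  by apply: gpath_isom; rewrite ?sl ?tl andbT ltW.
rewrite /cangle; case: ifPn => [_|]; last by rewrite eqxx.
rewrite real_normK ?num_real//.
rewrite (_ : s ^+ 2 + t ^+ 2 - (s - t) ^+ 2 = 2 * s * t); last by ring.
by rewrite divff ?acos1// !mulf_neq0 ?gt_eqF.
Unshelve. all: by end_near. Qed.

(* The space of directions at p is the metric completion of the set of
   geodesic directions: its points are the classes of Cauchy sequences of
   geodesics for the angle pseudometric. *)
Record cauchy_geodesics := CauchyGeodesics {
  cg_seq :> nat -> geodesic p;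
  cg_cauchy : forall e : R, 0 < e -> exists N : nat,
    forall m n : nat, (N <= m)%N -> (N <= n)%N -> gangle (cg_seq m) (cg_seq n) < e
}.

Definition cg_angle (x y : cauchy_geodesics) : R :=
  lim (gangle (x n) (y n) @[n --> \oo]).

Definition cg_class (x : cauchy_geodesics) : set cauchy_geodesics :=
  [set y | cg_angle x y = 0].

Lemma const_cauchy (g : geodesic p) (e : R) : 0 < e -> exists N : nat,
  forall m n : nat, (N <= m)%N -> (N <= n)%N -> gangle g g < e.
Proof. by move=> e0; exists 0%N => m n _ _; rewrite gangle_refl. Qed.

Definition const_geodesics (g : geodesic p) : cauchy_geodesics :=
  @CauchyGeodesics (fun=> g) (const_cauchy g).

End at_point.

Arguments cauchy_geodesics p : clear implicits.

Definition direction (p : M) :=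
  {C : set (cauchy_geodesics p) | exists x, C = cg_class x}.

Definition class_direction (p : M) (x : cauchy_geodesics p) : direction p :=
  exist _ (cg_class x) (ex_intro _ x erefl).

Definition direction_rep (p : M) (C : direction p) : cauchy_geodesics p :=
  sval (cid (svalP C)).

Definition angle (p : M) (xi eta : direction p) : R :=
  cg_angle (direction_rep xi) (direction_rep eta).

Definition dir (p : M) (g : geodesic p) : direction p :=
  class_direction (const_geodesics g).

Definition dirs (p q : M) : set (direction p) :=
  [set dir g | g in [set g : geodesic p | g (glen g) = q]].

Arguments dirs p q : clear implicits.

Definition set_angle (p : M) (A : set (direction p)) (xi : direction p) : R :=
  inf [set angle alpha xi | alpha in A].

End directions.

Arguments dirs {R M} p q.

Section invariants.
Context {R : realType}.

Definition metric_radius (M : metricType R) : R :=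
  inf (range (fun p : M => sup (range (fun q : M => mdist p q)))).

Definition ob_at (M : metricType R) (p q : M) : R :=
  sup [set set_angle (dirs p q) xi | xi in
       [set xi : direction p | exists2 x : M, metric_radius M / 2 <= mdist p x &
                                              dirs p x xi]] - pi / 2.

Definition ob_pair (M : metricType R) (p q : M) : R :=
  Num.max (ob_at p q) (ob_at q p).

(* The pairs p != q with |p, q| -> 0. *)
Definition close_pairs (M : metricType R) : set_system (M * M) :=
  filter_from [set d : R | 0 < d]
    (fun d => [set pq : M * M | pq.1 != pq.2 /\ mdist pq.1 pq.2 < d]).

Arguments close_pairs M : clear implicits.

Definition obtuse_constant (M : metricType R) : \bar R :=
  limf_einf (fun pq : M * M => (ob_pair pq.1 pq.2)%:E) (close_pairs M).

Definition geodesic_towards (M : metricType R) (p : M) (r : R)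
    (xi : direction p) : Prop :=
  exists2 g : geodesic p, r <= glen g & dir g = xi.

(* The supremum is taken in [0, +oo], so that it is 0 for the empty set. *)
Definition one_side_inj (M : metricType R) : \bar R :=
  ereal_sup (0%E |` [set r%:E | r in [set r : R | 0 <= r /\
    forall (p : M) (xi : direction p),
      geodesic_towards r xi \/
      exists2 eta : direction p, angle xi eta = pi & geodesic_towards r eta]]).

End invariants.

(* Main.v *)
(** Everything is local around [p] and first order. The four point condition
    gives the monotonicity of comparison angles, hence angles and the local hinge
    comparison.

    Let [g] start at [p] and let [q = g t] with [t] small. Since
    [ob(M) = pi / 2], either some geodesic of length [>= R / 2] from [p] makes an
    angle close to [pi] with [g], or some such geodesic from [q] makes an angle
    close to [pi] with the way back to [p], hence a small angle with [g] itself,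
    because three directions span angles of total at most [2 pi]. If the first
    alternative occurs for arbitrarily small errors, the geodesics found form a
    Cauchy sequence of directions (again by the bound [2 pi]) and converge to a
    geodesic opposite to [g]. Otherwise let [t] tend to [0]: by hinge comparison
    the geodesics from [q] converge to one from [p] that has the direction of
    [g]. Finally the set of directions of geodesics of length [>= R / 2] is
    closed, which passes from geodesic directions to their completion. *)

Require Import Defs.
From mathcomp Require Import all_boot all_order all_algebra.
From mathcomp Require Import all_classical all_reals all_analysis.
From mathcomp Require Import ring lra.

Import Order.TTheory GRing.Theory Num.Theory.
Import numFieldNormedType.Exports.

Local Open Scope classical_set_scope.
Local Open Scope ring_scope.

(** * Model functions of constant curvature *)

Section hyperbolic.
Context {R : realType}.
Implicit Types x y : R.

Lemma sinhD x y : sinh (x + y) = sinh x * cosh y + cosh x * sinh y.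
Proof. by rewrite /sinh /cosh opprD !expRD; field. Qed.

Lemma coshD x y : cosh (x + y) = cosh x * cosh y + sinh x * sinh y.
Proof. by rewrite /sinh /cosh opprD !expRD; field. Qed.

Lemma sinhN x : sinh (- x) = - sinh x.
Proof. by rewrite /sinh opprK; field. Qed.

Lemma coshN x : cosh (- x) = cosh x.
Proof. by rewrite /cosh opprK addrC. Qed.

Lemma is_derive_sinh x : is_derive x 1 (@sinh R) (cosh x).
Proof.
rewrite /sinh /cosh.
rewrite [X in is_derive _ _ X](_ : _ = 2^-1 \*: (expR - (expR \o -%R))); last first.
  by apply/funext => y /=; rewrite mulrC.
apply: is_derive_eq.
by rewrite mulrN1 opprK; exact: mulrC.
Qed.
End hyperbolic.

(** The error is relative to [x], so it survives in quotients of lengths, however small the triangle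
    is. *)
Lemma derive_at0_approx {R : realType} (f : R -> R) (e : R) :
  f 0 = 0 -> is_derive (0 : R) 1 f 1 -> 0 < e ->
  exists2 d : R, 0 < d & forall x, 0 < x < d -> `|f x - x| <= e * x.
Proof.
move=> f0 [df dv] e0; move: df; rewrite /derivable => /cvg_ex[l fl].
have l1 : l = 1.
  by rewrite -dv /derive; apply/esym/cvg_lim => //; exact: Rhausdorff.
move: fl; rewrite l1 => /cvgrPdist_le/(_ _ e0) [d /= d0 fd].
exists d => // x /andP[x0 xd].
have := fd x; rewrite /= sub0r normrN gtr0_norm// => /(_ xd).
rewrite gt_eqF// => /(_ isT); rewrite addr0 f0 subr0.
rewrite -[x *: 1]/(x * 1) mulr1 -[x^-1 *: f x]/(x^-1 * f x) => fx.
have -> : f x - x = - (x * (1 - x^-1 * f x)).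
  by field; rewrite gt_eqF.
by rewrite normrN normrM gtr0_norm// mulrC ler_pM2r.
Qed.

Section model.
Context {R : realType}.
Context (k : R).
Implicit Types x y : R.

Let w := Num.sqrt `|k|.

(** The solution of [f'' + k f = 0] with [f 0 = 0] and [f' 0 = 1]; [cs] is its derivative. Addition
    formulas valid for every [k] then replace the distinction of the sign of the curvature. *)
Definition sn x : R :=
  if k == 0 then x else
  if 0 < k then sin (w * x) / w else sinh (w * x) / w.

Definition cs x : R :=
  if k == 0 then 1 else if 0 < k then cos (w * x) else cosh (w * x).

Let w_neq0 : k != 0 -> w != 0.
Proof. by move=> k0; rewrite gt_eqF// sqrtr_gt0 normr_gt0. Qed.

Let w2 : w * w = `|k|. Proof. by rewrite -expr2 sqr_sqrtr. Qed.

Lemma snD x y : sn (x + y) = sn x * cs y + cs x * sn y.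
Proof.
rewrite /sn /cs; case: eqVneq => [_|/w_neq0 w0]; first by ring.
by case: ifP => _; rewrite mulrDr ?sinD ?sinhD; field.
Qed.

Lemma csD x y : cs (x + y) = cs x * cs y - k * sn x * sn y.
Proof.
rewrite /sn /cs; case: eqVneq => [->|k0]; first by ring.
have w0 := w_neq0 k0.
case: ltP => kp; rewrite mulrDr ?cosD ?coshD.
  by rewrite -[X in X * _ * _]gtr0_norm// -w2; field.
by rewrite -[X in X * _ * _]opprK -[X in - X * _ * _]ler0_norm// -w2; field.
Qed.

Lemma snN x : sn (- x) = - sn x.
Proof.
rewrite /sn; case: eqVneq => // _.
by case: ifP => _; rewrite mulrN ?sinN ?sinhN mulNr.
Qed.

Lemma csN x : cs (- x) = cs x.
Proof.
rewrite /cs; case: eqVneq => // _.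
by case: ifP => _; rewrite mulrN ?cosN ?coshN.
Qed.

Lemma sn0 : sn 0 = 0.
Proof. by have := snN 0; rewrite oppr0 => e; lra. Qed.

Lemma cs2_sn2 x : cs x ^+ 2 + k * sn x ^+ 2 = 1.
Proof.
transitivity (cs (x - x)); first by rewrite csD csN snN; ring.
rewrite subrr /cs mulr0 cos0 /cosh oppr0 expR0.
by case: ifP => // _; case: ifP => // _; field.
Qed.

Lemma is_derive_sn x : is_derive x 1 sn (cs x).
Proof.
rewrite /sn /cs.
case: eqVneq => [_|/w_neq0 w0].
  exact: is_derive_id.
case: ifP => _.
  rewrite [X in is_derive _ _ X](_ : _ = w^-1 \*: (sin \o (w \*: id))); last first.
    by apply/funext => y /=; rewrite mulrC.
  apply: is_derive_eq.
  by rewrite -[LHS]/(w^-1 * (cos (w * x) * (w * 1))); field.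
rewrite [X in is_derive _ _ X](_ : _ = w^-1 \*: (sinh \o (w \*: id))); last first.
  by apply/funext => y /=; rewrite mulrC.
have ? := @is_derive_sinh R.
apply: is_derive_eq.
by rewrite -[LHS]/(w^-1 * (cosh (w * x) * (w * 1))); field.
Qed.

Lemma continuous_sn : continuous sn.
Proof.
move=> x; apply/differentiable_continuous/derivable1_diffP.
by apply: ex_derive; exact: is_derive_sn.
Qed.

Lemma sn_approx (e : R) : 0 < e ->
  exists2 d : R, 0 < d & forall x, 0 < x < d -> `|sn x - x| <= e * x.
Proof.
apply: derive_at0_approx; first exact: sn0.
apply: is_derive_eq; first exact: is_derive_sn.
rewrite /cs mulr0 cos0 /cosh oppr0 expR0.
by case: ifP => // _; case: ifP => // _; field.
Qed.


(** The versine [(1 - cs x) / k], written with the half angle so that it also makes sense for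
    [k = 0], where it is [x ^+ 2 / 2]. *)
Definition vs x : R := 2 * sn (x / 2) ^+ 2.

Lemma cs_vs x : cs x = 1 - k * vs x.
Proof.
have := csD (x / 2) (x / 2); rewrite -splitr /vs => ->.
by have := cs2_sn2 (x / 2); lra.
Qed.

Lemma sn2_vs x : sn x ^+ 2 = vs x * (2 - k * vs x).
Proof.
have := snD (x / 2) (x / 2); rewrite -splitr /vs => ->.
have := cs2_sn2 (x / 2); set s := sn _; set c := cs _ => e.
transitivity (4 * s ^+ 2 * c ^+ 2); first by ring.
have -> : c ^+ 2 = 1 - k * s ^+ 2 by lra.
by ring.
Qed.

Lemma vsN x : vs (- x) = vs x.
Proof. by rewrite /vs mulNr snN sqrrN. Qed.

Lemma vsD x y : vs (x + y) = vs x + vs y * cs x + sn x * sn y.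
Proof.
have hx := splitr x; have hy := splitr y.
rewrite [in sn x]hx [in sn y]hy [in cs x]hx !snD csD /vs (mulrDl x y) snD.
set s := sn (x / 2); set c := cs (x / 2).
set s' := sn (y / 2); set c' := cs (y / 2).
have e : c ^+ 2 = 1 - k * s ^+ 2 by have := cs2_sn2 (x / 2); rewrite -/s -/c; lra.
have e' : c' ^+ 2 = 1 - k * s' ^+ 2 by have := cs2_sn2 (y / 2); rewrite -/s' -/c'; lra.
have -> : (s * c' + c * s') ^+ 2 = s ^+ 2 * c' ^+ 2 + c ^+ 2 * s' ^+ 2
  + 2 * (s * c * s' * c') by ring.
have -> : c * c - k * s * s = c ^+ 2 - k * s ^+ 2 by ring.
by rewrite e e'; ring.
Qed.

Lemma vsB x y : vs (x - y) = vs x + vs y * cs x - sn x * sn y.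
Proof. by rewrite vsD vsN snN; ring. Qed.

Lemma vs_sub x y : vs x - vs y = 2 * (sn ((x + y) / 2) * sn ((x - y) / 2)).
Proof.
transitivity (vs ((x + y) / 2 + (x - y) / 2) - vs ((x + y) / 2 - (x - y) / 2)).
  by congr (vs _ - vs _); field.
by rewrite vsB vsD; ring.
Qed.

Lemma continuous_vs : continuous vs.
Proof.
move=> x; rewrite /vs.
apply: cvgM; first exact: cvg_cst.
have c : sn (y / 2) @[y --> x] --> sn (x / 2).
  apply: continuous_cvg; first exact: continuous_sn.
  by apply: cvgM; [exact: cvg_id|exact: cvg_cst].
by rewrite expr2; under eq_fun do rewrite expr2; exact: cvgM.
Qed.

(* One minus the cosine of the comparison angle. *)
Definition cver a b c : R := (vs c - vs (a - b)) / (sn a * sn b).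

Lemma cverC a b c : cver a b c = cver b a c.
Proof. by rewrite /cver -[in vs (b - a)]opprB vsN [sn a * _]mulrC. Qed.

(** Written with versines, the law of cosines loses its factor [k], and one formula covers all three
    cases of [cangle]. *)
Lemma cangleE a b c : sn a != 0 -> sn b != 0 ->
  cangle k a b c = acos (1 - cver a b c).
Proof.
have [k0|k0] := eqVneq k 0.
  rewrite /cangle /cver /vs /sn k0 eqxx => a0 b0; congr acos.
  by field; rewrite a0 b0.
move=> sa sb.
have -> : 1 - cver a b c =
    (cs c - cs a * cs b) / (k * (sn a * sn b)).
  by rewrite /cver vsB !cs_vs; field; rewrite sb sa.
move: sa sb; rewrite /cangle /sn /cs (negbTE k0) -/w.
have w0 := w_neq0 k0.
case: ltP => kp sa sb; congr acos.
  have -> : k = w * w by rewrite w2 gtr0_norm.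
  move: sa sb; rewrite !mulf_eq0 !negb_or => /andP[sa _] /andP[sb _].
  by field; rewrite w0 sb sa.
have -> : k = - (w * w) by rewrite w2 ler0_norm ?opprK.
have {}sa : sinh (w * a) != 0 by apply: contraNneq sa => ->; rewrite mul0r.
have {}sb : sinh (w * b) != 0 by apply: contraNneq sb => ->; rewrite mul0r.
by field; rewrite w0 sb sa.
Qed.

End model.

(** * Inverse cosine and comparison angles in the model surfaces *)

Lemma acos_in_itv {R : realType} (x : R) : -1 <= x <= 1 -> acos x \in `[0, pi].
Proof. by move=> x1; rewrite in_itv/= acos_ge0// acos_lepi. Qed.

Lemma le_acos {R : realType} (x y : R) :
  -1 <= x -> x <= y -> y <= 1 -> acos y <= acos x.
Proof.
move=> x1 xy y1.
have xi : -1 <= x <= 1 by rewrite x1 (le_trans xy).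
have yi : -1 <= y <= 1 by rewrite y1 (le_trans x1).
rewrite leNgt -(ltr_cos (acos_in_itv _ xi) (acos_in_itv _ yi)).
by rewrite !acosK ?in_itv//= -leNgt.
Qed.

(* The library only has continuity in the interior, but the angles 0 and pi
   are precisely those of interest here. *)
Lemma acos_approx {R : realType} (x e : R) : -1 <= x <= 1 -> 0 < e ->
  exists2 d : R, 0 < d &
    forall y, -1 <= y <= 1 -> `|y - x| < d -> `|acos y - acos x| < e.
Proof.
move=> x1 e0; have := acos_in_itv _ x1; have cx : cos (acos x) = x by rewrite acosK.
set a := acos x in cx *; rewrite in_itv/= => /andP[a0 api].
pose d1 := if a + e <= pi then x - cos (a + e) else 1.
pose d2 := if 0 <= a - e then cos (a - e) - x else 1.
have d10 : 0 < d1.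
  rewrite /d1; case: ifP => // h; rewrite -cx subr_gt0 ltr_cos ?in_itv/=; lra.
have d20 : 0 < d2.
  rewrite /d2; case: ifP => // h; rewrite -cx subr_gt0 ltr_cos ?in_itv/=; lra.
exists (Num.min d1 d2); first by rewrite lt_min d10.
move=> y y1; rewrite lt_min !ltr_norml => /andP[/andP[h1 _] /andP[_ h2]].
have := acos_in_itv _ y1; have cy : cos (acos y) = y by rewrite acosK.
set b := acos y in cy *; rewrite in_itv/= => /andP[b0 bpi].
apply/andP; split; rewrite ltNge; apply/negP => ab.
- move: h2; rewrite /d2 ifT; last by lra.
  suff : cos (a - e) <= y by lra.
  by rewrite -cy leNgt ltr_cos ?in_itv/=; lra.
- move: h1; rewrite /d1 ifT; last by lra.
  suff : y <= cos (a + e) by lra.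
  by rewrite -cy leNgt ltr_cos ?in_itv/=; lra.
Qed.

Section comparison_angle.
Context {R : realType} {k : R}.
Implicit Types a b c u v x y e rho : R.
Local Notation sn := (sn k).
Local Notation vs := (vs k).
Local Notation cver := (cver k).

(** This is what keeps triangles small: positivity of [sn] on the lengths involved stands in for the
    perimeter bound when [k > 0]. *)
Lemma sn_gt0_near : exists2 rho, 0 < rho & forall x, 0 < x < rho -> 0 < sn x.
Proof.
have [rho r0 snr] := @sn_approx R k 2^-1 ltac:(by []).
exists rho => // x xr; have := snr _ xr; rewrite ler_norml.
by move: xr => /andP[x0 _] /andP[h _]; lra.
Qed.

Definition triangle_sides a b c : Prop := [/\ 0 < a, 0 < b & `|a - b| <= c <= a + b].

Context (rho : R).
Context (sn_gt0 : forall x, 0 < x < rho -> 0 < sn x).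

Lemma sn_ge0 x : 0 <= x < rho -> 0 <= sn x.
Proof.
move=> /andP[x0 xr]; have [->|xn0] := eqVneq x 0; first by rewrite sn0.
by rewrite ltW// sn_gt0// xr andbT lt_neqAle eq_sym xn0.
Qed.

Lemma le_vs u v : 0 <= u -> u <= v -> v < rho -> vs u <= vs v.
Proof.
move=> u0 uv vr; rewrite -subr_ge0 vs_sub mulr_ge0// mulr_ge0// sn_ge0//; lra.
Qed.

Lemma vs_norm u : vs `|u| = vs u.
Proof. by case: (ger0P u) => // _; rewrite vsN. Qed.

(** The extreme values belong to the degenerate triangles [c = |a - b|] and [c = a + b]; in between
    [vs] is monotone. *)
Lemma cver_itv a b c : triangle_sides a b c -> a + b < rho -> 0 <= cver a b c <= 2.
Proof.
move=> [a0 b0 /andP[c1 c2]] abr.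
have ab : 0 < sn a * sn b by apply: mulr_gt0; apply: sn_gt0; lra.
rewrite /cver divr_ge0//=; last 2 first.
- by rewrite subr_ge0 -vs_norm le_vs//; lra.
- exact: ltW.
rewrite ler_pdivrMr// lerBlDr (le_trans (le_vs _ _ _ c2 _)) ?(le_trans _ c1)//.
by rewrite vsD vsB; lra.
Qed.

Lemma cangle_acos a b c : 0 < a -> 0 < b -> a + b < rho ->
  cangle k a b c = acos (1 - cver a b c).
Proof. by move=> a0 b0 abr; apply: cangleE; rewrite gt_eqF// sn_gt0//; lra. Qed.

Lemma cos_cangle a b c : triangle_sides a b c -> a + b < rho ->
  cos (cangle k a b c) = 1 - cver a b c.
Proof.
move=> abc abr; have := cver_itv _ _ _ abc abr; case: abc => a0 b0 _ S02.
by rewrite cangle_acos// acosK// in_itv/=; lra.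
Qed.

Lemma cangle_itv a b c : triangle_sides a b c -> a + b < rho ->
  0 <= cangle k a b c <= pi.
Proof.
move=> abc abr; have := cver_itv _ _ _ abc abr; case: abc => a0 b0 _ S02.
by rewrite cangle_acos//; apply: acos_in_itv; lra.
Qed.

End comparison_angle.

Lemma sn_flat {R : realType} (x : R) : sn 0 x = x.
Proof. by rewrite /sn eqxx. Qed.

Lemma sn_flat_gt0 {R : realType} (B u : R) : 0 < u < B -> 0 < sn 0 u.
Proof. by move=> /andP[u0 _]; rewrite sn_flat. Qed.

Lemma cver_half {R : realType} (k a b c : R) :
  cver k a b c = 2 * (sn k ((c + a - b) / 2) * sn k ((c - a + b) / 2))
                 / (sn k a * sn k b).
Proof. by rewrite /cver vs_sub; congr (_ * (sn k (_ / 2) * sn k (_ / 2)) / _); ring. Qed.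

(** Curvature is invisible to first order: [cver_half] is a quotient of products of values of [sn],
    and each of them differs from its argument by a small relative error. *)
Lemma cver_approx {R : realType} (k e : R) : 0 < e ->
  exists2 d : R, 0 < d & forall a b c, triangle_sides a b c -> a + b < d ->
    `|cver k a b c - cver 0 a b c| <= e.
Proof.
(* The four factors cost a relative error of at most [16 * q]; as the flat value is at most 2, the
   absolute error is at most [32 * q]. *)
move=> e0; pose q := Num.min (16^-1) (e / 32).
have q0 : 0 < q by rewrite lt_min; apply/andP; split; lra.
have q16 : q <= 16^-1 by rewrite ge_min lexx.
have qe : 32 * q <= e by have : q <= e / 32 by [rewrite ge_min lexx orbT]; lra.
have [d d0 snd] := @sn_approx R k q q0.
have sn_bnd x : 0 <= x < d -> (1 - q) * x <= sn k x <= (1 + q) * x.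
  move=> /andP[x0 xd]; have [->|xn0] := eqVneq x 0; first by rewrite sn0 !mulr0 lexx.
  have := snd x; rewrite xd andbT lt_neqAle eq_sym xn0 => /(_ x0).
  by rewrite ler_norml; lra.
exists d => // a b c abc abd.
have flat : 0 <= cver 0 a b c <= 2.
  by apply: (@cver_itv _ _ d) => // x /andP[x0 _]; rewrite sn_flat.
move: flat; case: abc => a0 b0; rewrite ler_norml => /andP[/andP[h1 h2] h3].
rewrite !cver_half !sn_flat.
set u := (c + a - b) / 2; set v := (c - a + b) / 2 => flat.
have u0 : 0 <= u by rewrite /u; lra.
have v0 : 0 <= v by rewrite /v; lra.
have ud : u < d by rewrite /u; lra.
have vd : v < d by rewrite /v; lra.
have /andP[ul uu] : (1 - q) * u <= sn k u <= (1 + q) * u by apply: sn_bnd; rewrite u0.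
have /andP[vl vu] : (1 - q) * v <= sn k v <= (1 + q) * v by apply: sn_bnd; rewrite v0.
have /andP[al au] : (1 - q) * a <= sn k a <= (1 + q) * a by apply: sn_bnd; lra.
have /andP[bl bu] : (1 - q) * b <= sn k b <= (1 + q) * b by apply: sn_bnd; lra.
have q1 : 0 <= 1 - q by lra.
have q1' : 0 <= 1 + q by lra.
have UVu : sn k u * sn k v <= ((1 + q) * u) * ((1 + q) * v).
  by apply: ler_pM => //; [apply: le_trans ul|apply: le_trans vl]; exact: mulr_ge0.
have UVl : ((1 - q) * u) * ((1 - q) * v) <= sn k u * sn k v.
  by apply: ler_pM => //; exact: mulr_ge0.
have ABu : sn k a * sn k b <= ((1 + q) * a) * ((1 + q) * b).
  apply: ler_pM => //; [apply: le_trans al|apply: le_trans bl]; apply: mulr_ge0 => //; exact: ltW.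
have ABl : ((1 - q) * a) * ((1 - q) * b) <= sn k a * sn k b.
  by apply: ler_pM => //; apply: mulr_ge0 => //; exact: ltW.
set f := 2 * (u * v) / (a * b) in flat *.
have fE : 2 * (u * v) = f * (a * b) by rewrite /f; field; rewrite !gt_eqF.
have ab0 : 0 < a * b by exact: mulr_gt0.
have AB0 : 0 < sn k a * sn k b.
  by apply: lt_le_trans ABl; rewrite mulr_gt0// mulr_gt0//; lra.
have q16u : (1 + q) ^+ 2 <= (1 + 16 * q) * (1 - q) ^+ 2 by nra.
have q16l : (1 - 16 * q) * (1 + q) ^+ 2 <= (1 - q) ^+ 2 by nra.
have fq : f * q <= 2 * q by rewrite ler_pM2r//; case/andP: flat.
have f0 : 0 <= f by case/andP: flat.
have lo : (1 - 16 * q) * f <= 2 * (sn k u * sn k v) / (sn k a * sn k b).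
  rewrite ler_pdivlMr//; apply: (@le_trans _ _ ((1 - 16 * q) * f * ((1 + q) * a * ((1 + q) * b)))).
    by apply: ler_wpM2l => //; apply: mulr_ge0 => //; lra.
  apply: (@le_trans _ _ (2 * ((1 - q) * u * ((1 - q) * v)))); last by lra.
  have -> : 2 * ((1 - q) * u * ((1 - q) * v)) = (1 - q) ^+ 2 * (f * (a * b)) by rewrite -fE; ring.
  have -> : (1 - 16 * q) * f * ((1 + q) * a * ((1 + q) * b)) =
    (1 - 16 * q) * (1 + q) ^+ 2 * (f * (a * b)) by ring.
  by apply: ler_wpM2r => //; apply: mulr_ge0 => //; exact: ltW.
have hi : 2 * (sn k u * sn k v) / (sn k a * sn k b) <= (1 + 16 * q) * f.
  rewrite ler_pdivrMr//.
  apply: (@le_trans _ _ ((1 + 16 * q) * f * ((1 - q) * a * ((1 - q) * b)))); last first.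
    by apply: ler_wpM2l => //; apply: mulr_ge0 => //; lra.
  apply: (@le_trans _ _ (2 * ((1 + q) * u * ((1 + q) * v)))); first by lra.
  have -> : 2 * ((1 + q) * u * ((1 + q) * v)) = (1 + q) ^+ 2 * (f * (a * b)) by rewrite -fE; ring.
  have -> : (1 + 16 * q) * f * ((1 - q) * a * ((1 - q) * b)) =
    (1 + 16 * q) * (1 - q) ^+ 2 * (f * (a * b)) by ring.
  by apply: ler_wpM2r => //; apply: mulr_ge0 => //; exact: ltW.
by rewrite ler_norml; apply/andP; split; lra.
Qed.

(* Stewart's theorem for a point at distance [s] from one end of a segment of
   length [x + y] lying on the same line. *)
Lemma line_stewart {R : realType} (k s x y : R) :
  sn k y * vs k s + sn k x * vs k (s - (x + y)) =
  sn k (x + y) * vs k (s - x) + sn k y * vs k x + sn k x * vs k y.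
Proof.
have -> : vs k (s - (x + y)) = vs k (x + y - s) by rewrite -vsN opprB.
have -> : vs k (s - x) = vs k (x - s) by rewrite -vsN opprB.
rewrite !vsB vsD csD snD !cs_vs.
have := sn2_vs k x.
set X := vs k x; set Y := vs k y; set S := vs k s.
set a := sn k x; set b := sn k y; set c := sn k s => e.
have e' : a * a = X * (2 - k * X) by rewrite -e expr2.
apply/eqP; rewrite -subr_eq0; apply/eqP.
transitivity ((b - S * k * b) * (a * a - X * (2 - k * X))); last first.
  by rewrite e' subrr mulr0.
ring.
Qed.

(** * Comparison angles under the four point condition *)

Section four_point.
Context {R : realType} {M : metricType R} (k : R).
Implicit Types p q w x y z : M.
Local Notation d := (@mdist R M).

(* [vertex_cver k a b c] is attached to the comparison angle at [a]. *)
Definition vertex_cver a b c : R := cver k (d a b) (d a c) (d b c).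

(** Distances in the ball are below [2 * r], so [4 * r] bounds the sum of two sides of any triangle
    in it. *)
Definition comparison_ball x (r : R) : Prop :=
  [/\ 0 < r, four_point_condition k (ball x r) &
      forall u, 0 < u < 4 * r -> 0 < sn k u].

Lemma triangle_sides_mdist a b c : a != b -> a != c ->
  triangle_sides (d a b) (d a c) (d b c).
Proof.
move=> ab ac; split; rewrite ?mdist_gt0//; apply/andP; split.
  rewrite ler_norml; have := metric_triangle a b c; have := metric_triangle a c b.
  by rewrite (metric_sym c b); lra.
by rewrite (metric_sym a b) metric_triangle.
Qed.

Lemma alexandrov_comparison_ball : alexandrov k M ->
  forall x, exists r, comparison_ball x r.
Proof.
move=> A x; have [U xU fU] := alexandrov_curv A x.
have [rho rho0 snr] := @sn_gt0_near R k.
move/nbhs_ballP: xU => [r /= r0 rU].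
exists (Num.min r (rho / 4)); split.
- by rewrite lt_min r0/= divr_gt0.
- have sub : ball x (Num.min r (rho / 4)) `<=` U.
    by apply: (subset_trans _ rU); apply: le_ball; rewrite ge_min lexx.
  by move=> a b c e ba bb bc be; apply: fU; exact: sub.
- move=> u /andP[u0 ur]; apply: snr; rewrite u0 (lt_le_trans ur)//.
  by have : Num.min r (rho / 4) <= rho / 4 by [rewrite ge_min lexx orbT]; lra.
Qed.

Context {x0 : M} {r : R} (xr : comparison_ball x0 r).
Local Notation B := (ball x0 r).

Lemma comparison_ball_gt0 : 0 < r.
Proof. by case: xr. Qed.

Lemma comparison_ball_sn u : 0 < u < 4 * r -> 0 < sn k u.
Proof. by case: xr => _ _; exact. Qed.

Lemma ball_mdist a b : B a -> B b -> d a b < 2 * r.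
Proof.
rewrite ballEmdist/= => a1 b1; have := metric_triangle a x0 b.
by rewrite (metric_sym a x0); lra.
Qed.

Lemma ball_mdist2 a b c : B a -> B b -> B c -> d a b + d a c < 4 * r.
Proof.
move=> Ba Bb Bc; have := ball_mdist _ _ Ba Bb; have := ball_mdist _ _ Ba Bc; lra.
Qed.

Lemma vertex_cver_itv a b c : B a -> B b -> B c -> a != b -> a != c ->
  0 <= vertex_cver a b c <= 2.
Proof.
move=> Ba Bb Bc ab ac; apply: (cver_itv _ comparison_ball_sn).
  exact: triangle_sides_mdist.
exact: ball_mdist2.
Qed.

(** At a point [a] between [b] and [c] the comparison angle of [b] and [c] is [pi]. The four point
    condition leaves at most [pi] for the other two, so their cosines have nonnegative sum. *)
Lemma straight_cver_sum a b c w : B a -> B b -> B c -> B w ->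
  uniq [:: a; b; c; w] -> d b c = d a b + d a c ->
  vertex_cver a c w + vertex_cver a w b <= 2.
Proof.
move=> Ba Bb Bc Bw u bc; case: (xr) => r0 /(_ a b c w Ba Bb Bc Bw u) fp snr.
move: u; rewrite /= !inE !negb_or !andbT => /and3P[/and3P[ab ac aw] /andP[_ bw] cw].
have := ball_mdist2 _ _ _ Ba Bb Bc; have := ball_mdist2 _ _ _ Ba Bc Bw.
have := ball_mdist2 _ _ _ Ba Bw Bb => l1 l2 l3.
have acw := triangle_sides_mdist _ _ _ ac aw.
have awb := triangle_sides_mdist _ _ _ aw ab.
have := cos_cangle _ snr _ _ _ acw l2.
have := cos_cangle _ snr _ _ _ awb l1.
have := cangle_itv _ snr _ _ _ acw l2.
have := cangle_itv _ snr _ _ _ awb l1.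
rewrite -/(vertex_cver a c w) -/(vertex_cver a w b); move: fp.
have -> : cangle k (d a b) (d a c) (d b c) = pi.
  rewrite (cangle_acos _ snr) ?mdist_gt0// bc /cver vsD vsB.
  rewrite (_ : 1 - _ = -1) ?acosN1//.
  by field; rewrite !gt_eqF// snr// mdist_gt0 ?ab ?ac/=; have := mdist_ge0 a b; have := mdist_ge0 a c; lra.
set t := cangle k (d a c) _ _; set t' := cangle k (d a w) _ _ => fp it' it ct' ct.
suff : cos (pi - t') <= cos t by rewrite cosB cospi sinpi; lra.
by rewrite leNgt ltr_cos ?in_itv/=; lra.
Qed.

(* Alexandrov's lemma: the comparison angle at [q] decreases when the side
   [qy] is prolonged to [qz]. *)
Lemma vertex_cver_prolong q w y z : B q -> B w -> B y -> B z ->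
  q != w -> q != y -> d q z = d q y + d y z ->
  vertex_cver q w z <= vertex_cver q w y.
Proof.
move=> Bq Bw By Bz qw qy qz.
(* Coincidences are treated apart, since the four point condition speaks of distinct points. *)
have [->//|yz] := eqVneq y z.
have qz' : q != z.
  by rewrite -mdist_gt0 qz ltr_wpDr// ?mdist_gt0// mdist_ge0.
have [E|wz] := eqVneq w z.
  have -> : vertex_cver q w z = 0.
    by rewrite /vertex_cver /cver E mdistxx !subrr mul0r.
  by have /andP[] := vertex_cver_itv q w y Bq Bw By qw qy.
have [E|wy] := eqVneq w y.
  rewrite E /vertex_cver /cver mdistxx qz opprD addrA !subrr sub0r vsN !subrr.
  by rewrite !mul0r.
have sn_d a b : B a -> B b -> a != b -> 0 < sn k (d a b).
  move=> Ba Bb ab; apply: comparison_ball_sn; rewrite mdist_gt0 ab/=.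
  have := ball_mdist _ _ Ba Bb; have := comparison_ball_gt0; lra.
have sz := sn_d _ _ Bq Bz qz'; have sy := sn_d _ _ Bq By qy.
have sw := sn_d _ _ Bq Bw qw; have syz := sn_d _ _ By Bz yz.
have syw : 0 < sn k (d y w) by apply: sn_d => //; rewrite eq_sym.
have := straight_cver_sum y q z w By Bq Bz Bw.
rewrite /= !inE !negb_or !andbT (eq_sym y q) qy yz (eq_sym y w) wy qz' qw (eq_sym z w) wz.
move=> /(_ isT); rewrite (metric_sym y q) => /(_ qz).
rewrite /vertex_cver /cver ler_pdivrMr; last exact: mulr_gt0.
rewrite mulrAC ler_pdivlMr; last exact: mulr_gt0.
rewrite (metric_sym y q) (metric_sym w z) (metric_sym w q) (metric_sym w y).
set s := d q w; set x := d q y; set t := d y z; set e := d y w.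
rewrite qz -/x -/t => sum2.
(* With this identity the bound at [y] becomes Stewart's theorem as an inequality for the points
   [q], [y], [z] seen from [w]. *)
have key : sn k x * vs k (t - e) + sn k t * vs k (e - x) + 2 * (sn k t * sn k e * sn k x) =
    sn k x * vs k t + sn k t * vs k x + vs k e * sn k (x + t).
  have -> : vs k (e - x) = vs k (x - e) by rewrite -vsN opprB.
  by rewrite !vsB snD; ring.
have {}sum2 : (vs k (d z w) - vs k (t - e)) * sn k x +
    (vs k s - vs k (e - x)) * sn k t <= 2 * (sn k t * sn k e * sn k x).
  have p0 : 0 < sn k t * sn k e * sn k x by rewrite !mulr_gt0.
  move: sum2; rewrite -(ler_pM2r p0); congr (_ <= _).
  by field; rewrite !gt_eqF.
(* Equality holds when [w] lies on the model line; subtracting that case leaves the comparison at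
   [q]. *)
have line := line_stewart k s x t.
suff main : sn k x * (vs k (d z w) - vs k (s - (x + t))) <=
    sn k (x + t) * (vs k e - vs k (s - x)).
  by move: main; rewrite -(ler_pM2l sw); congr (_ <= _); ring.
by lra.
Qed.
End four_point.

(** * Angles between geodesics with a common origin *)

Section geodesic_distance.
Context {R : realType} {M : metricType R} {p : M}.
Implicit Types g h : geodesic p.

Lemma geodesic_mdist0 g s : 0 <= s <= glen g -> mdist p (g s) = s.
Proof.
move=> sg; have g0 := glen_gt0 g.
have := @gpath_isom _ _ _ g 0 s; rewrite gpath0 => ->//; last by rewrite lexx ltW.
by rewrite sub0r normrN ger0_norm//; case/andP: sg.
Qed.

Lemma geodesic_mdist g s t : 0 <= s -> s <= t -> t <= glen g -> mdist (g s) (g t) = t - s.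
Proof.
move=> s0 st tg; rewrite gpath_isom; last 2 first.
- by rewrite s0 (le_trans st).
- by rewrite tg (le_trans s0).
by rewrite distrC ger0_norm// subr_ge0.
Qed.

Lemma geodesic_neq g s : 0 < s <= glen g -> p != g s.
Proof.
move=> /andP[s0 sg].
by rewrite -mdist_gt0 geodesic_mdist0// (ltW s0).
Qed.

End geodesic_distance.

Section geodesic_angle.
Context {R : realType} {M : metricType R} {k : R} {x0 : M} {r : R}.
Context (xr : comparison_ball k x0 r) {p : M} (xp : mdist x0 p < r / 2).
Implicit Types g h l : geodesic p.
Local Notation d := (@mdist R M).

(** Half the radius, because [p] itself may lie up to [r / 2] away from the centre: the same ball
    has to serve at nearby points of a geodesic. *)
Definition short (r' : R) g (s : R) : bool := [&& 0 < s, s <= glen g & s < r' / 2].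

Local Notation sh := (short r).

Lemma short_glen g s : sh g s -> 0 < s <= glen g.
Proof. by case/and3P=> -> ->. Qed.

Lemma short_mdist g s : sh g s -> d p (g s) = s.
Proof. by move=> /and3P[s0 sg _]; apply: geodesic_mdist0; rewrite ltW. Qed.

Lemma short_ball g s : sh g s -> ball x0 r (g s).
Proof.
move=> gs; have e := short_mdist _ _ gs; case/and3P: gs => _ _ sr.
rewrite ballEmdist/=; have := metric_triangle x0 p (g s); have := xp; lra.
Qed.

Lemma center_ball : ball x0 r p.
Proof. by rewrite ballEmdist/=; have := comparison_ball_gt0 _ xr; have := xp; lra. Qed.

Lemma short_neq g s : sh g s -> p != g s.
Proof. by move/short_glen; exact: geodesic_neq. Qed.

Lemma short_le g s t : sh g t -> 0 < s -> s <= t -> sh g s.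
Proof.
by move=> /and3P[t0 tg tr] s0 st; rewrite /short s0 (le_trans st tg) (le_lt_trans st tr).
Qed.

Lemma short_cver g h s t : sh g s -> sh h t ->
  vertex_cver k p (g s) (h t) = cver k s t (d (g s) (h t)).
Proof. by move=> gs ht; rewrite /vertex_cver !short_mdist. Qed.

Lemma short_triangle g h s t : sh g s -> sh h t -> triangle_sides s t (d (g s) (h t)).
Proof.
move=> gs ht; rewrite -{1}(short_mdist _ _ gs) -{1}(short_mdist _ _ ht).
by apply: triangle_sides_mdist; exact: short_neq.
Qed.

Lemma short_near g : exists2 e : R, 0 < e & forall s, 0 < s < e -> sh g s.
Proof.
exists (Num.min (glen g) (r / 2)).
  by rewrite lt_min glen_gt0 divr_gt0// (comparison_ball_gt0 _ xr).
by move=> s; rewrite lt_min => /and3P[s0 sg sr]; rewrite /short s0 (ltW sg).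
Qed.

Lemma short_cver_itv g h s t : sh g s -> sh h t ->
  0 <= cver k s t (d (g s) (h t)) <= 2.
Proof.
move=> gs ht; rewrite -short_cver//.
apply: (vertex_cver_itv _ xr); rewrite ?(short_neq _ _ gs) ?(short_neq _ _ ht)//.
- exact: center_ball.
- exact: short_ball.
- exact: short_ball.
Qed.

Lemma cver_antitone_r g h s t t' : sh g s -> sh h t' -> 0 < t -> t <= t' ->
  cver k s t' (d (g s) (h t')) <= cver k s t (d (g s) (h t)).
Proof.
move=> gs ht' t0 tt'; have ht := short_le _ _ _ ht' t0 tt'.
rewrite -!short_cver//; apply: (vertex_cver_prolong _ xr).
- exact: center_ball.
- exact: short_ball.
- exact: short_ball.
- exact: short_ball.
- exact: short_neq gs.
- exact: short_neq ht.
- rewrite !short_mdist// geodesic_mdist ?(ltW t0)//; first by ring.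
  by case/andP: (short_glen _ _ ht').
Qed.

Lemma cver_antitone g h s t s' t' : sh g s' -> sh h t' ->
  0 < s -> s <= s' -> 0 < t -> t <= t' ->
  cver k s' t' (d (g s') (h t')) <= cver k s t (d (g s) (h t)).
Proof.
move=> gs ht s0 ss t0 tt; have gs0 := short_le _ _ _ gs s0 ss.
apply: le_trans (cver_antitone_r _ _ _ _ _ gs0 ht t0 tt).
rewrite cverC metric_sym [leRHS]cverC [d (g s) _]metric_sym.
by apply: cver_antitone_r.
Qed.

(** A bounded function antitone in both lengths tends to its supremum as they shrink to 0. *)
Lemma cver_limit g h : exists L : R, [/\ 0 <= L <= 2,
  forall s t, sh g s -> sh h t -> cver k s t (d (g s) (h t)) <= L &
  forall e, 0 < e -> exists2 D : R, 0 < D & forall s t, 0 < s < D -> 0 < t < D ->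
    `|cver k s t (d (g s) (h t)) - L| < e].
Proof.
pose E : set R := [set cver k u.1 u.2 (d (g u.1) (h u.2)) |
                   u in [set u : R * R | sh g u.1 /\ sh h u.2]].
have [a a0 ag] := short_near g; have [b b0 bh] := short_near h.
have ga2 : sh g (a / 2) by apply: ag; lra.
have hb2 : sh h (b / 2) by apply: bh; lra.
have E0 : E !=set0 by eexists; exists (a / 2, b / 2).
have Eub : ubound E 2.
  by move=> _ [[s t] /= [gs ht] <-]; have /andP[] := short_cver_itv _ _ _ _ gs ht.
have supE : has_sup E by split => //; exists 2.
have ubE s t : sh g s -> sh h t -> cver k s t (d (g s) (h t)) <= sup E.
  by move=> gs ht; apply: ub_le_sup; [exists 2|exists (s, t)].
exists (sup E); split => //.
  rewrite ge_sup// andbT (le_trans _ (ubE _ _ ga2 hb2))//.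
  by have /andP[] := short_cver_itv _ _ _ _ ga2 hb2.
move=> e e0; have [_ [[s t] /= [gs ht] <-] Le] := sup_adherent e0 supE.
have s0 : 0 < s by case/andP: (short_glen _ _ gs).
have t0 : 0 < t by case/andP: (short_glen _ _ ht).
(* Below a pair that almost attains the supremum, all values are at least as large. *)
exists (Num.min s t); first by rewrite lt_min s0.
move=> s' t'; rewrite !lt_min => /and3P[s'0 s's s't] /and3P[t'0 t's t't].
have gs' := short_le _ _ _ gs s'0 (ltW s's).
have ht' := short_le _ _ _ ht t'0 (ltW t't).
have := cver_antitone _ _ _ _ _ _ gs ht s'0 (ltW s's) t'0 (ltW t't).
have := ubE _ _ gs' ht'; rewrite ltr_norml => h1 h2.
by apply/andP; split; lra.
Qed.

End geodesic_angle.

Section angle.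
Context {R : realType} {M : metricType R} {k : R} {x0 : M} {r : R}.
Context (xr : comparison_ball k x0 r) {p : M} (xp : mdist x0 p < r / 2).
Implicit Types g h l : geodesic p.
Local Notation d := (@mdist R M).
Local Notation sh := (short r).
(** Angles are defined by Euclidean comparison angles, whereas monotonicity concerns those of
    curvature [k]. Both have the same limit, and [L] is one minus its cosine. *)
Lemma gangle_limit g h : exists L : R, [/\ 0 <= L <= 2, gangle g h = acos (1 - L),
  forall s t, sh g s -> sh h t -> cver k s t (d (g s) (h t)) <= L,
  forall e, 0 < e -> exists2 D : R, 0 < D & forall s t, 0 < s < D -> 0 < t < D ->
    `|cangle k s t (d (g s) (h t)) - acos (1 - L)| < e &
  forall e, 0 < e -> exists2 D : R, 0 < D & forall s t, 0 < s < D -> 0 < t < D ->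
    `|cangle 0 s t (d (g s) (h t)) - acos (1 - L)| < e].
Proof.
have [L [L02 hinge apL]] := cver_limit xr xp g h.
have r0 := comparison_ball_gt0 _ xr.
have [a a0 ag] := short_near xr g; have [b b0 bh] := short_near xr h.
have L1 : -1 <= 1 - L <= 1 by lra.
have apk : forall e, 0 < e -> exists2 D : R, 0 < D & forall s t, 0 < s < D -> 0 < t < D ->
    `|cangle k s t (d (g s) (h t)) - acos (1 - L)| < e.
  move=> e e0; have [q q0 acq] := acos_approx _ _ L1 e0.
  have [D D0 Dq] := apL _ q0.
  exists (Num.min D (Num.min a b)); first by rewrite !lt_min D0 a0.
  move=> s t; rewrite !lt_min => /and4P[s0 sD sa sb] /and4P[t0 tD ta tb].
  have gs : sh g s by apply: ag; rewrite s0.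
  have ht : sh h t by apply: bh; rewrite t0.
  have c02 := short_cver_itv xr xp _ _ _ _ gs ht.
  rewrite (cangle_acos _ (comparison_ball_sn _ xr))//; last first.
    by move: gs ht => /and3P[_ _ ?] /and3P[_ _ ?]; lra.
  apply: acq; first by lra.
  have := Dq s t; rewrite s0 sD t0 tD => /(_ isT isT).
  by rewrite !ltr_norml => /andP[? ?]; apply/andP; split; lra.
have ap0 : forall e, 0 < e -> exists2 D : R, 0 < D & forall s t, 0 < s < D -> 0 < t < D ->
    `|cangle 0 s t (d (g s) (h t)) - acos (1 - L)| < e.
  move=> e e0; have [q q0 acq] := acos_approx _ _ L1 e0.
  (* One half for the distance to the limit, one half for replacing curvature [k] by 0. *)
  have q20 : 0 < q / 2 by rewrite divr_gt0.
  have [D D0 Dq] := apL _ q20.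
  have [C C0 Cq] := @cver_approx _ k _ q20.
  exists (Num.min (Num.min D (C / 2)) (Num.min a b)).
    by rewrite !lt_min D0 a0 divr_gt0.
  move=> s t; rewrite !lt_min -!andbA => /and5P[s0 sD sC sa sb] /and5P[t0 tD tC ta tb].
  have gs : sh g s by apply: ag; rewrite s0.
  have ht : sh h t by apply: bh; rewrite t0.
  have st := short_triangle _ _ _ _ gs ht.
  have := cver_itv (s + t + 1) (sn_flat_gt0 _) _ _ _ st.
  rewrite ltrDl => /(_ ltr01) c02.
  rewrite (cangle_acos (s + t + 1) (sn_flat_gt0 _))//; last by rewrite ltrDl.
  apply: acq; first by lra.
  have := Cq _ _ _ st; have := Dq s t; rewrite s0 sD t0 tD => /(_ isT isT).
  move=> + /(_ ltac:(lra)); rewrite !ltr_norml ler_norml => /andP[? ?] /andP[? ?].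
  by apply/andP; split; lra.
exists L; split => //.
pose F := filter_prod (0 : R)^'+ (0 : R)^'+.
have FF : ProperFilter F by exact: filter_prod_proper.
apply: (@cvg_lim R _ _ F FF); first exact: Rhausdorff.
apply/cvgrPdist_lt => e e0; have [D D0 De] := ap0 _ e0.
have near_pos : \forall s \near (0 : R)^'+, 0 < s < D.
  near=> s; apply/andP; split; near: s; first exact: nbhs_right_gt.
  exact: nbhs_right_lt.
exists ([set s | 0 < s < D], [set s | 0 < s < D]) => //.
by move=> [s t] /= [sD tD]; rewrite distrC; exact: De.
Unshelve. all: by end_near. Qed.

Lemma gangle_itv g h : 0 <= gangle g h <= pi.
Proof.
have [L [L02 -> _ _ _]] := gangle_limit g h.
by have := @acos_in_itv R (1 - L) ltac:(lra); rewrite in_itv.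
Qed.

(* The local form of Toponogov's hinge comparison. *)
Lemma gangle_hinge g h s t : sh g s -> sh h t ->
  cver k s t (d (g s) (h t)) <= 1 - cos (gangle g h).
Proof.
move=> gs ht; have [L [L02 -> hinge _ _]] := gangle_limit g h.
by rewrite acosK ?in_itv/=; [have := hinge _ _ gs ht; lra|lra].
Qed.

Lemma gangle_approx g h e : 0 < e ->
  exists2 D : R, 0 < D & forall s t, 0 < s < D -> 0 < t < D ->
    gangle g h - e < cangle k s t (d (g s) (h t)) < gangle g h + e.
Proof.
have [L [_ -> _ + _]] := gangle_limit g h => /[apply] -[D D0 De].
by exists D => // s t sD tD; rewrite -ltr_distl; exact: De.
Qed.

Lemma gangle_approx_flat g h e : 0 < e ->
  exists2 D : R, 0 < D & forall s t, 0 < s < D -> 0 < t < D ->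
    gangle g h - e < cangle 0 s t (d (g s) (h t)) < gangle g h + e.
Proof.
have [L [_ -> _ _]] := gangle_limit g h => /[apply] -[D D0 De].
by exists D => // s t sD tD; rewrite -ltr_distl; exact: De.
Qed.

(** The limit is known to exist, so arbitrarily small pairs of lengths determine it. *)
Lemma gangle_unique g h a :
  (forall e D, 0 < e -> 0 < D -> exists s t, [/\ 0 < s < D, 0 < t < D &
     `|cangle 0 s t (d (g s) (h t)) - a| < e]) -> gangle g h = a.
Proof.
move=> ha; apply/eqP; rewrite -subr_eq0 -normr_le0; apply/ler_addgt0Pl => e e0.
have e20 : 0 < e / 2 by rewrite divr_gt0.
have [D D0 De] := gangle_approx_flat g h _ e20.
have [s [t [sD tD]]] := ha _ _ e20 D0; have := De s t sD tD.
move: (cangle _ _ _ _) (gangle _ _) => c b /andP[bc cb].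
by rewrite ltr_norml ler_norml => /andP[ac ca]; apply/andP; split; lra.
Qed.

Lemma gangle_sym g h : gangle g h = gangle h g.
Proof.
apply: gangle_unique => e D e0 D0.
have [C C0 Ce] := gangle_approx_flat h g _ e0.
pose s := Num.min C D / 2.
have m0 : 0 < Num.min C D by rewrite lt_min C0.
have mC : Num.min C D <= C by rewrite ge_min lexx.
have mD : Num.min C D <= D by rewrite ge_min lexx orbT.
have s0 : 0 < s by rewrite divr_gt0.
exists s, s; split; [rewrite s0/= /s; lra|rewrite s0/= /s; lra|].
rewrite metric_sym ltr_distl; apply: Ce; rewrite s0/= /s; lra.
Qed.

(** The converse of the hinge comparison, tested on arbitrarily small pairs only; it bounds angles
    with limit geodesics. *)
Lemma gangle_le g h a : 0 <= a <= pi ->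
  (forall D, 0 < D -> exists s t, [/\ 0 < s < D, 0 < t < D &
     cver k s t (d (g s) (h t)) <= 1 - cos a]) -> gangle g h <= a.
Proof.
move=> api ha; apply/ler_addgt0Pr => e e0.
have [D D0 De] := gangle_approx g h _ e0.
have [b b0 bg] := short_near xr g; have [c c0 ch] := short_near xr h.
have m0 : 0 < Num.min D (Num.min b c) by rewrite !lt_min D0 b0.
have [s [t []]] := ha _ m0; rewrite !lt_min => /and4P[s0 sD sb sc] /and4P[t0 tD tb tc] sta.
have gs : sh g s by apply: bg; rewrite s0.
have ht : sh h t by apply: ch; rewrite t0.
have c02 := short_cver_itv xr xp _ _ _ _ gs ht.
have := De s t; rewrite s0 sD t0 tD => /(_ isT isT).
rewrite (cangle_acos _ (comparison_ball_sn _ xr))//; last first.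
  by move: gs ht (comparison_ball_gt0 _ xr) => /and3P[_ _ ?] /and3P[_ _ ?] ?; lra.
move=> /andP[h1 _].
suff acos_a : acos (1 - cver k s t (d (g s) (h t))) <= a.
  by clear -h1 acos_a; lra.
rewrite -[leRHS]cosK ?in_itv//=; apply: le_acos; last by lra.
- by have := cos_geN1 a.
- by lra.
Qed.

(** The four point condition at [p] and the three points at distance [s], as [s] tends to 0. *)
Lemma gangle_sum3 g h l : gangle g h + gangle h l + gangle l g <= 2 * pi.
Proof.
apply/ler_addgt0Pr => e e0; have e30 : 0 < e / 3 by rewrite divr_gt0.
have [D1 D10 h1] := gangle_approx g h _ e30.
have [D2 D20 h2] := gangle_approx h l _ e30.
have [D3 D30 h3] := gangle_approx l g _ e30.
have [a a0 ag] := short_near xr g; have [b b0 bh] := short_near xr h.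
have [c c0 cl] := short_near xr l.
set m := Num.min (Num.min D1 (Num.min D2 D3)) (Num.min a (Num.min b c)).
have m0 : 0 < m by rewrite !lt_min D10 D20 D30 a0 b0.
pose s := m / 2; have s0 : 0 < s by rewrite divr_gt0.
have : s < m by rewrite /s; lra.
rewrite !lt_min -!andbA => /and5P[s1 s2 s3 sa /andP[sb sc]].
have := h1 s s; have := h2 s s; have := h3 s s.
rewrite s0 s1 s2 s3 => /(_ isT isT) + /(_ isT isT) + /(_ isT isT).
move=> /andP[h3a _] /andP[h2a _] /andP[h1a _].
have gs : sh g s by apply: ag; rewrite s0.
have hs : sh h s by apply: bh; rewrite s0.
have ls : sh l s by apply: cl; rewrite s0.
suff sum3 : cangle k s s (d (g s) (h s)) + cangle k s s (d (h s) (l s)) +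
  cangle k s s (d (l s) (g s)) <= 2 * pi by clear -h1a h2a h3a sum3; lra.
clear h1 h2 h3 h1a h2a h3a.
have snr := comparison_ball_sn _ xr.
have ssr : s + s < 4 * r.
  by move: gs (comparison_ball_gt0 _ xr) => /and3P[_ _ sr] r0; clear -sr r0; lra.
have itv (g1 g2 : geodesic p) : sh g1 s -> sh g2 s -> 0 <= cangle k s s (d (g1 s) (g2 s)) <= pi.
  move=> gs1 gs2; apply: (cangle_itv _ snr) => //.
  exact: short_triangle _ _ _ _ gs1 gs2.
have c0' : cangle k s s 0 = 0.
  by rewrite (cangle_acos _ snr)// /cver !subrr mul0r subr0 acos1.
(* If two of the points coincide, one comparison angle is 0 and the other two are at most [pi]. *)
have [E|gh] := eqVneq (g s) (h s).
  have := itv _ _ ls gs; rewrite E mdistxx c0'; have := itv _ _ hs ls.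
  by clear; lra.
have [E|hl] := eqVneq (h s) (l s).
  have := itv _ _ gs ls; have := itv _ _ ls gs; rewrite E mdistxx c0'.
  by clear; lra.
have [E|lg] := eqVneq (l s) (g s).
  have := itv _ _ gs hs; have := itv _ _ hs gs; rewrite E mdistxx c0'.
  by clear; lra.
have [_ fp _] := xr.
have := fp p (g s) (h s) (l s) (center_ball xr xp) (short_ball xp _ _ gs)
  (short_ball xp _ _ hs) (short_ball xp _ _ ls).
rewrite (short_mdist _ _ gs) (short_mdist _ _ hs) (short_mdist _ _ ls); apply.
rewrite /= !inE !negb_or gh hl (eq_sym (g s)) lg (short_neq _ _ gs) (short_neq _ _ hs).
by rewrite (short_neq _ _ ls).
Qed.
End angle.

(** * The Euclidean law of cosines and the triangle inequality for angles *)

Section flat.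
Context {R : realType}.
Implicit Types a b c s t : R.

Lemma cver_flat a b c : a != 0 -> b != 0 ->
  cver 0 a b c = (c ^+ 2 - (a - b) ^+ 2) / (2 * (a * b)).
Proof. by move=> a0 b0; rewrite cver_half !sn_flat; field; rewrite a0 b0. Qed.

(* The law of cosines in the triangle with sides [s] and [s * cos x / cos y]
   enclosing the angle [x + y]. *)
Lemma flat_side (x y s c : R) : 0 < s -> 0 < cos x -> 0 < cos y -> 0 < x + y < pi ->
  triangle_sides s (s * (cos x / cos y)) c ->
  cangle 0 s (s * (cos x / cos y)) c <= x + y -> c <= s * (sin (x + y) / cos y).
Proof.
move=> s0 cx cy /andP[xy0 xypi] tri le_xy; set t := s * _ in tri le_xy.
have t0 : 0 < t by case: tri.
have c0 : 0 <= c by case: tri => _ _ /andP[+ _]; apply: le_trans.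
have st : s + t < s + t + 1 by rewrite ltrDl.
have := cangle_itv _ (sn_flat_gt0 _) _ _ _ tri st.
have := cos_cangle _ (sn_flat_gt0 _) _ _ _ tri st.
move: le_xy; set a := cangle _ _ _ _ => le_xy ca /andP[a0 api].
have : cos (x + y) <= cos a by rewrite leNgt ltr_cos ?in_itv/=; lra.
rewrite ca cver_flat ?gt_eqF// => cc.
have {}cc : c ^+ 2 <= s ^+ 2 + t ^+ 2 - 2 * (s * t) * cos (x + y).
  have st0 : 0 < 2 * (s * t) by rewrite mulr_gt0// mulr_gt0.
  have : (c ^+ 2 - (s - t) ^+ 2) / (2 * (s * t)) <= 1 - cos (x + y) by lra.
  by rewrite ler_pdivrMr//; lra.
have u0 : 0 <= s * (sin (x + y) / cos y).
  by rewrite mulr_ge0 ?(ltW s0)// divr_ge0 ?(ltW cy)// sin_ge0_pi// !ltW.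
rewrite -(ler_pXn2r (n := 2))// ?nnegrE//; apply: (le_trans cc).
rewrite le_eqVlt; apply/orP; left; apply/eqP.
have -> : (s * (sin (x + y) / cos y)) ^+ 2 = s ^+ 2 * (1 - cos (x + y) ^+ 2) / cos y ^+ 2.
  by rewrite -sin2cos2; field; rewrite gt_eqF.
have ex : sin x ^+ 2 = 1 - cos x ^+ 2 by exact: sin2cos2.
have ey : sin y ^+ 2 = 1 - cos y ^+ 2 by exact: sin2cos2.
rewrite /t cosD; set X := cos x in cx ex *; set Y := cos y in cy ey *.
set A := sin x in ex *; set B := sin y in ey *.
apply/eqP; rewrite -subr_eq0; apply/eqP.
transitivity (s ^+ 2 / Y ^+ 2 * (A ^+ 2 * B ^+ 2 - (1 - X ^+ 2) * (1 - Y ^+ 2))).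
  by field; rewrite gt_eqF.
by rewrite ex ey subrr mulr0.
Qed.

End flat.

Section angle.
Context {R : realType} {M : metricType R} {k : R} {x0 : M} {r : R}.
Context (xr : comparison_ball k x0 r) {p : M} (xp : mdist x0 p < r / 2).
Implicit Types g h l : geodesic p.
Local Notation d := (@mdist R M).
Local Notation sh := (short r).
(** The model is an isosceles triangle with legs [s] and apex angle [2 * x], cut by a segment from
    the apex at angle [y] to the height. The segment has length [s * (cos x / cos y)], and the two
    parts of the base add up to [2 * s * sin x]. *)
Lemma gangle_triangle g h l : gangle g l <= gangle g h + gangle h l.
Proof.
have /andP[a0 api] := gangle_itv xr xp g h.
have /andP[b0 bpi] := gangle_itv xr xp h l.
have /andP[c0 cpi] := gangle_itv xr xp g l.
have [|abpi] := leP pi (gangle g h + gangle h l); first exact: le_trans.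
apply/ler_addgt0Pr => e' e'0.
set a := gangle g h in a0 api abpi *; set b := gangle h l in b0 bpi abpi *.
(* The three approximations cost [3 * e] in all, and the apex angle [a + b + 2 * e] has to stay
   below [pi]. *)
pose e := Num.min (e' / 3) ((pi - a - b) / 4).
have e0 : 0 < e by rewrite lt_min; apply/andP; split; lra.
have ee' : 3 * e <= e' by have : e <= e' / 3 by [rewrite ge_min lexx]; lra.
have epi : 4 * e <= pi - a - b.
  by have : e <= (pi - a - b) / 4 by [rewrite ge_min lexx orbT]; lra.
(* Thus [x + y = a + e] and [x - y = b + e] are the two parts of the apex angle. *)
pose x := (a + b) / 2 + e; pose y := (a - b) / 2.
have cx : 0 < cos x by apply: cos_gt0_pihalf; rewrite /x; lra.
have cy : 0 < cos y by apply: cos_gt0_pihalf; rewrite /y; lra.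
pose m := cos x / cos y; have m0 : 0 < m by rewrite divr_gt0.
have [D1 D10 h1] := gangle_approx_flat xr xp g h _ e0.
have [D2 D20 h2] := gangle_approx_flat xr xp h l _ e0.
have [D3 D30 h3] := gangle_approx_flat xr xp g l _ e0.
have [B1 B10 sg] := short_near xr g; have [B2 B20 sh] := short_near xr h.
have [B3 B30 sl] := short_near xr l.
set D := Num.min (Num.min D1 (Num.min D2 D3)) (Num.min B1 (Num.min B2 B3)).
have D0 : 0 < D by rewrite !lt_min D10 D20 D30 B10 B20.
(* With this choice [s + s * m = D / 2], so both lengths are below every threshold. *)
pose s := D / (2 * (1 + m)).
have m1 : 0 < 1 + m by lra.
have s0 : 0 < s by rewrite divr_gt0// mulr_gt0.
have sD : s + s * m < D.
  have -> : s + s * m = D / 2 by rewrite /s; field; rewrite gt_eqF.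
  by lra.
clearbody s; have t0 : 0 < s * m by rewrite mulr_gt0.
have : s < D by lra.
rewrite !lt_min -!andbA => /and5P[s1 s2 s3 s4 /andP[s5 s6]].
have : s * m < D by lra.
rewrite !lt_min -!andbA => /and5P[t1 t2 t3 t4 /andP[t5 t6]].
have gs : short r g s by apply: sg; rewrite s0.
have ht : short r h (s * m) by apply: sh; rewrite t0.
have ls : short r l s by apply: sl; rewrite s0.
have := h1 s (s * m); have := h2 (s * m) s; have := h3 s s.
rewrite s0 t0 s1 s2 s3 t1 t2 => /(_ isT isT) + /(_ isT isT) + /(_ isT isT).
move=> /andP[h3a _] /andP[_ h2b] /andP[_ h1b]; clear h1 h2 h3 sg sh sl.
have pi0 := pi_gt0 R.
have xye : 0 < a + e < pi by clear -a0 b0 e0 epi; lra.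
have xNye : 0 < b + e < pi by clear -a0 b0 e0 epi; lra.
have x2 : 0 <= 2 * x <= pi by rewrite /x; clear -a0 b0 e0 epi; lra.
clear -s0 t0 cx cy m0 gs ht ls h1b h2b h3a ee' xye xNye x2.
have xy : x + y = a + e by rewrite /x /y; field.
have xNy : x + - y = b + e by rewrite /x /y; field.
have d1 : d (g s) (h (s * m)) <= s * (sin (x + y) / cos y).
  apply: flat_side => //; first by rewrite xy.
    exact: short_triangle _ _ _ _ gs ht.
  by rewrite xy -/m; exact: ltW.
have d2 : d (h (s * m)) (l s) <= s * (sin (x + - y) / cos (- y)).
  rewrite metric_sym; apply: flat_side => //; rewrite ?cosN//; first by rewrite xNy.
    exact: short_triangle _ _ _ _ ls ht.
  have E : cangle 0 s (s * m) (d (l s) (h (s * m))) =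
      cangle 0 (s * m) s (d (h (s * m)) (l s)).
    by rewrite metric_sym /cangle eqxx; congr (acos (_ / _)); ring.
  by rewrite xNy -/m E; exact: ltW.
have d3 : d (g s) (l s) <= 2 * s * sin x.
  apply: le_trans (metric_triangle _ (h (s * m)) _) _.
  apply: le_trans (lerD d1 d2) _.
  rewrite le_eqVlt; apply/orP; left; apply/eqP.
  by rewrite !sinD cosN sinN; field; rewrite gt_eqF.
suff le_x : cangle 0 s s (d (g s) (l s)) <= 2 * x.
  by move: le_x; rewrite /x; clear -h3a ee'; lra.
rewrite -[leRHS]cosK; last by rewrite in_itv.
have tri := short_triangle _ _ _ _ gs ls.
have ss : s + s < s + s + 1 by rewrite ltrDl.
have /andP[v0 v2] := cver_itv _ (sn_flat_gt0 _) _ _ _ tri ss.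
rewrite (cangle_acos _ (sn_flat_gt0 _) _ _ _ s0 s0 ss).
apply: le_acos; [exact: cos_geN1| |by rewrite gerBl].
have -> : cos (2 * x) = 1 - 2 * sin x ^+ 2.
  by rewrite (_ : 2 * x = x + x); [rewrite cosD -expr2 cos2sin2; ring|ring].
rewrite lerD2l lerN2 cver_flat ?gt_eqF// subrr expr0n/= subr0.
rewrite ler_pdivrMr ?mulr_gt0//.
have -> : 2 * sin x ^+ 2 * (2 * (s * s)) = (2 * s * sin x) ^+ 2 by ring.
rewrite ler_pXn2r ?nnegrE ?mdist_ge0//.
by apply: le_trans d3; exact: mdist_ge0.
Qed.
End angle.

(** * The space of directions *)

Section directions.
Context {R : realType} {M : metricType R} {k : R} {x0 : M} {r : R}.
Context (xr : comparison_ball k x0 r) {p : M} (xp : mdist x0 p < r / 2).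
Implicit Types x y z : @cauchy_geodesics R M p.

(** By the triangle inequality the angles form a Cauchy sequence, so the [lim] in [cg_angle] is a
    genuine limit. *)
Lemma cg_angle_approx x y e : 0 < e -> exists N, forall n, (N <= n)%N ->
  cg_angle x y - e < gangle (x n) (y n) < cg_angle x y + e.
Proof.
move=> e0.
have cv : cvg (gangle (x n) (y n) @[n --> \oo]).
  apply: cauchy_cvg; apply: cauchy_exP => q q0; have q20 : 0 < q / 2 by rewrite divr_gt0.
  have [N1 h1] := cg_cauchy x q20; have [N2 h2] := cg_cauchy y q20.
  have close i j : (maxn N1 N2 <= i)%N -> (maxn N1 N2 <= j)%N ->
      gangle (x i) (y i) < gangle (x j) (y j) + q.
    rewrite !geq_max => /andP[i1 i2] /andP[j1 j2].
    have := h1 i j i1 j1; have := h2 j i j2 i2.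
    have := gangle_triangle xr xp (x i) (x j) (y i).
    have := gangle_triangle xr xp (x j) (y j) (y i).
    move: (gangle (x i) (y i)) (gangle (x i) (x j)) (gangle (x j) (y j)).
    by move: (gangle (x j) (y i)) (gangle (y j) (y i)); clear; move=> *; lra.
  exists (gangle (x (maxn N1 N2)) (y (maxn N1 N2))), (maxn N1 N2) => // n /= Nn.
  by rewrite -ball_normE /= ltr_distl ltrBlDr !close.
have {}cv : gangle (x n) (y n) @[n --> \oo] --> cg_angle x y by exact: cv.
have /cvgrPdist_lt/(_ _ e0)[N _ hN] := cv.
by exists N => n Nn; have := hN n Nn; rewrite /= distrC ltr_distl.
Qed.

Lemma cg_angle_sym x y : cg_angle x y = cg_angle y x.
Proof.
rewrite /cg_angle (_ : (fun n => gangle (x n) (y n)) = fun n => gangle (y n) (x n)).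
  by [].
by apply/funext => n; rewrite (gangle_sym xr xp (x n)).
Qed.

Lemma cg_angle_itv x y : 0 <= cg_angle x y <= pi.
Proof.
apply/andP; split.
  apply/ler_addgt0Pr => e e0; have [N /(_ _ (leqnn _))] := cg_angle_approx x y _ e0.
  have := gangle_itv xr xp (x N) (y N).
  by move: (gangle _ _) (cg_angle _ _); clear; move=> a b /andP[? ?] /andP[? ?]; lra.
apply/ler_addgt0Pr => e e0; have [N /(_ _ (leqnn _))] := cg_angle_approx x y _ e0.
have := gangle_itv xr xp (x N) (y N).
by move: (gangle _ _) (cg_angle _ _); clear; move=> a b /andP[? ?] /andP[? ?]; lra.
Qed.

Lemma cg_angle_approx3 x y x' y' x'' y'' e : 0 < e -> exists n,
  [/\ cg_angle x y - e < gangle (x n) (y n) < cg_angle x y + e,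
      cg_angle x' y' - e < gangle (x' n) (y' n) < cg_angle x' y' + e &
      cg_angle x'' y'' - e < gangle (x'' n) (y'' n) < cg_angle x'' y'' + e].
Proof.
move=> e0; have [N1 h1] := cg_angle_approx x y _ e0.
have [N2 h2] := cg_angle_approx x' y' _ e0; have [N3 h3] := cg_angle_approx x'' y'' _ e0.
exists (maxn N1 (maxn N2 N3)); split; [apply: h1|apply: h2|apply: h3];
  by rewrite !leq_max leqnn ?orbT.
Qed.

Lemma cg_angle_triangle x y z : cg_angle x z <= cg_angle x y + cg_angle y z.
Proof.
apply/ler_addgt0Pr => e e0; have e30 : 0 < e / 3 by rewrite divr_gt0.
have [n []] := cg_angle_approx3 x z x y y z _ e30.
have := gangle_triangle xr xp (x n) (y n) (z n).
move: (gangle (x n) (y n)) (gangle (y n) (z n)) (gangle (x n) (z n)) => a b c.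
move: (cg_angle x y) (cg_angle y z) (cg_angle x z) => a' b' c'.
by move=> ? /andP[? ?] /andP[? ?] /andP[? ?]; lra.
Qed.

Lemma cg_angle_sum3 x y z : cg_angle x y + cg_angle y z + cg_angle z x <= 2 * pi.
Proof.
apply/ler_addgt0Pr => e e0; have e30 : 0 < e / 3 by rewrite divr_gt0.
have [n []] := cg_angle_approx3 x y y z z x _ e30.
have := gangle_sum3 xr xp (x n) (y n) (z n).
move: (gangle (x n) (y n)) (gangle (y n) (z n)) (gangle (z n) (x n)) => a b c.
move: (cg_angle x y) (cg_angle y z) (cg_angle z x) => a' b' c'.
by move=> ? /andP[? ?] /andP[? ?] /andP[? ?]; lra.
Qed.

Lemma cg_angle_const (g h : geodesic p) :
  cg_angle (const_geodesics g) (const_geodesics h) = gangle g h.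
Proof. by rewrite /cg_angle /=; exact: lim_cst. Qed.

Lemma cg_anglexx x : cg_angle x x = 0.
Proof.
rewrite /cg_angle (_ : (fun n => gangle (x n) (x n)) = fun=> 0); first exact: lim_cst.
by apply/funext => n; exact: gangle_refl.
Qed.

(** Directions of geodesics are dense in the completion. *)
Lemma cg_angle_seq x e : 0 < e -> exists n, cg_angle x (const_geodesics (x n)) < e.
Proof.
move=> e0; have e20 : 0 < e / 2 by rewrite divr_gt0.
have [N hN] := cg_cauchy x e20; have [N' hN'] := cg_angle_approx x (const_geodesics (x N)) _ e20.
exists N; have := hN (maxn N N') N (leq_maxl _ _) (leqnn _).
have := hN' (maxn N N') (leq_maxr _ _) => /=.
by move: (gangle _ _) (cg_angle _ _); clear; move=> a b /andP[? ?] ?; lra.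
Qed.

Lemma cg_angle_eq0_trans x y z : cg_angle x y = 0 -> cg_angle x z = cg_angle y z.
Proof.
move=> xy; have xz := cg_angle_triangle x y z; have yz := cg_angle_triangle y x z.
rewrite xy add0r in xz; rewrite (cg_angle_sym y x) xy add0r in yz.
by apply: le_anti; apply/andP; split; [exact: xz|exact: yz].
Qed.

Lemma eq_cg_class x y : cg_angle x y = 0 -> cg_class x = cg_class y.
Proof.
by move=> xy; apply/seteqP; split => z /=; rewrite /cg_class/= (cg_angle_eq0_trans x y).
Qed.

Lemma eq_class_direction x y : cg_angle x y = 0 -> class_direction x = class_direction y.
Proof. by move=> xy; apply: eq_exist => /=; exact: eq_cg_class. Qed.

Lemma direction_repK (C : direction p) : class_direction (direction_rep C) = C.
Proof.
case: C => C eC; apply: eq_exist; rewrite /direction_rep.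
by case: cid => x /= ->.
Qed.

(** The representative chosen from the class need not be [x], but it is at angle 0 from it. *)
Lemma cg_angle_rep x : cg_angle (direction_rep (class_direction x)) x = 0.
Proof.
have := direction_repK (class_direction x); set y := direction_rep _ => /(congr1 sval) /= e.
by have : cg_class y x by rewrite e; exact: cg_anglexx.
Qed.

Lemma angle_class x y : angle (class_direction x) (class_direction y) = cg_angle x y.
Proof.
have e z : cg_angle (direction_rep (class_direction x)) z = cg_angle x z.
  exact: cg_angle_eq0_trans _ _ _ (cg_angle_rep x).
have e' z : cg_angle (direction_rep (class_direction y)) z = cg_angle y z.
  exact: cg_angle_eq0_trans _ _ _ (cg_angle_rep y).
by rewrite /angle e (cg_angle_sym x) e' (cg_angle_sym y).
Qed.
End directions.

(** * Limits of long geodesics *)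

Lemma ultra_cvg_compact {I : Type} {T : topologicalType} (U : set_system I) (u : I -> T) :
  UltraFilter U -> compact [set: T] -> exists y : T, u i @[i --> U] --> y.
Proof.
move=> UU cT; have [y [_ cy]] := cT (u i @[i --> U]) _ filterT.
exists y => V yV; have [//|UV] := in_ultra_setVsetC (u @^-1` V) UU.
by have [z []] := cy (~` V) V UV yV.
Qed.

Lemma mdist_cvg {R : realType} {M : metricType R} {I : Type} (F : set_system I)
    (u v : I -> M) (y z : M) : Filter F ->
  u i @[i --> F] --> y -> v i @[i --> F] --> z ->
  mdist (u i) (v i) @[i --> F] --> mdist y z.
Proof.
move=> FF uy vz; apply/cvgrPdist_lt => e e0.
have e20 : 0 < e / 2 by rewrite divr_gt0.
near=> i.
have ui : ball y (e / 2) (u i) by near: i; exact/uy/nbhsx_ballx.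
have vi : ball z (e / 2) (v i) by near: i; exact/vz/nbhsx_ballx.
move: ui vi; rewrite !ballEmdist/= => ui vi.
have := metric_triangle (u i) y (v i); have := metric_triangle y z (v i).
have := metric_triangle y (u i) z; have := metric_triangle (u i) (v i) z.
rewrite (metric_sym (u i) y) (metric_sym (v i) z) ltr_norml => ? ? ? ?.
by apply/andP; split; lra.
Unshelve. all: by end_near. Qed.

Lemma cver_cvg {R : realType} {I : Type} (F : set_system I) (k a b c : R) (u : I -> R) :
  Filter F -> u i @[i --> F] --> c -> cver k a b (u i) @[i --> F] --> cver k a b c.
Proof.
move=> FF uc; apply: cvgM; last exact: cvg_cst.
apply: cvgB; last exact: cvg_cst.
by apply: (continuous_cvg _ _ uc); exact: continuous_vs.
Qed.

(** Along an ultrafilter all parameters converge at once, which does the work of Arzelà-Ascoli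
    without subsequences; the isometry relation passes to the limit. *)
Lemma geodesic_cvg {R : realType} {M : metricType R} {I : Type} (U : set_system I)
    (q : I -> M) (p : M) (c : forall i, geodesic (q i)) (L : R) :
  UltraFilter U -> compact [set: M] -> q i @[i --> U] --> p ->
  0 < L -> (forall i, L <= glen (c i)) ->
  exists2 g : geodesic p, glen g = L &
    forall s, c i s @[i --> U] --> g s.
Proof.
move=> UU cM qp L0 cL.
have [f fE] := choice (fun s => ultra_cvg_compact U (fun i => c i s) UU cM).
have f0 : f 0 = p.
  apply: (@cvg_unique _ (@metric_hausdorff _ M) (c i 0 @[i --> U]) _ _ _ (fE 0)).
  rewrite (_ : (fun i => c i 0) = q)//.
  by apply/funext => i; exact: gpath0.
have fI s t : 0 <= s <= L -> 0 <= t <= L -> mdist (f s) (f t) = `|s - t|.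
  move=> /andP[s0 sL] /andP[t0 tL].
  apply: (@cvg_unique _ (@Rhausdorff R) (mdist (c i s) (c i t) @[i --> U])).
    exact: mdist_cvg.
  apply: cvg_near_cst; apply: filterE => i.
  by apply: gpath_isom; rewrite ?s0 ?t0 (le_trans _ (cL i)).
by exists (@Geodesic _ _ p L f L0 f0 fI).
Qed.

Lemma subset_ultrafilter_nat : exists2 U : set_system nat, UltraFilter U & \oo `<=` U.
Proof. by have [U [UU sU]] := ultraFilterLemma (_ : ProperFilter \oo); exists U. Qed.

(** If [P] fails at some [e1], it fails below [e1], so [Q] holds there and by monotonicity
    everywhere. *)
Lemma forall_small_or {R : realType} (P Q : R -> Prop) :
  (forall e e', 0 < e -> e <= e' -> P e -> P e') ->
  (forall e e', 0 < e -> e <= e' -> Q e -> Q e') ->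
  (forall e, 0 < e -> P e \/ Q e) ->
  (forall e, 0 < e -> P e) \/ (forall e, 0 < e -> Q e).
Proof.
move=> Pmono Qmono PQ; have [allP|] := pselect (forall e, 0 < e -> P e); first by left.
move=> /existsNP[e1 /not_implyP[e10 nP]]; right=> e e0.
have m0 : 0 < Num.min e e1 by rewrite lt_min e0.
have [Pm|Qm] := PQ _ m0.
  by case: nP; apply: Pmono Pm => //; rewrite ge_min lexx orbT.
by apply: Qmono Qm => //; rewrite ge_min lexx.
Qed.

Lemma harmonic_lt {R : realType} (e : R) : 0 < e ->
  exists N, forall n, (N <= n)%N -> harmonic n < e.
Proof.
move=> e0; have /cvgrPdist_lt/(_ _ e0)[N _ hN] := @cvg_harmonic R.
exists N => n /hN /=; rewrite sub0r normrN ger0_norm//.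
Qed.

Section long_geodesics.
Context {R : realType} {M : metricType R} {k : R} {x0 : M} {r : R}.
Context (xr : comparison_ball k x0 r) {p : M} (xp : mdist x0 p < r / 2).
Context (M_compact : compact [set: M]) {L : R} (L0 : 0 < L).

(** Pointwise convergence of geodesics does not by itself control directions at [p]; the hinge
    comparison at a fixed small length does. *)
Lemma long_geodesics_closed (c : nat -> geodesic p) : (forall n, L <= glen (c n)) ->
  (forall n m, gangle (c n) (c m) < harmonic n + harmonic m) ->
  exists2 g : geodesic p, L <= glen g &
    forall e, 0 < e -> exists n, harmonic n < e /\ gangle (c n) g < e.
Proof.
move=> cL cc; have [U UU sU] := subset_ultrafilter_nat.
have [|g gL cg] := @geodesic_cvg _ _ _ U (fun=> p) p c L UU M_compact _ L0 cL.
  exact: cvg_cst.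
exists g; first by rewrite gL.
(* Capped at [pi], where the cosine is still monotone. *)
move=> e e0; pose e' := Num.min (e / 2) pi.
have e'0 : 0 < e' by rewrite lt_min divr_gt0//= pi_gt0.
have e'pi : e' <= pi by rewrite ge_min lexx orbT.
have e'e : e' < e by have : e' <= e / 2 by [rewrite ge_min lexx]; lra.
have e'20 : 0 < e' / 2 by rewrite divr_gt0.
have [N hN] := harmonic_lt _ e'20.
exists N; split; first by have := hN N (leqnn _); lra.
apply: le_lt_trans e'e; apply: (gangle_le xr xp); first by rewrite e'pi ltW.
move=> D D0; have r0 := comparison_ball_gt0 _ xr.
pose s := Num.min D (Num.min L (r / 2)) / 2.
have m0 : 0 < Num.min D (Num.min L (r / 2)) by rewrite !lt_min D0 L0 divr_gt0.
have s0 : 0 < s by rewrite divr_gt0.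
have : s < Num.min D (Num.min L (r / 2)) by rewrite /s; lra.
rewrite !lt_min => /and3P[sD sL sr].
exists s, s; rewrite s0 sD; split=> //.
have sh m : short r (c m) s by rewrite /short s0 sr (le_trans (ltW sL) (cL m)).
(* Here [N] is fixed and [m] tends to infinity: the hinge inequality for [c N] and [c m] becomes one
   for [c N] and [g]. *)
have cv : cver k s s (mdist (c N s) (c m s)) @[m --> U] --> cver k s s (mdist (c N s) (g s)).
  by apply: cver_cvg; apply: mdist_cvg (cg s); exact: cvg_cst.
apply: cvgr_to_le cv _; apply: sU; exists N => // m /= Nm.
apply: le_trans (gangle_hinge xr xp _ _ _ _ (sh N) (sh m)) _.
rewrite lerD2l lerN2 leNgt ltr_cos ?in_itv//=; last 2 first.
- by rewrite e'pi ltW.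
- by have := gangle_itv xr xp (c N) (c m).
rewrite -leNgt (le_trans (ltW (cc N m)))//.
by have := hN N (leqnn _); have := hN m Nm; lra.
Qed.

Lemma long_direction_closed (x : @cauchy_geodesics R M p) :
  (forall e, 0 < e -> exists2 c : geodesic p, L <= glen c &
     cg_angle x (const_geodesics c) < e) ->
  exists2 c : geodesic p, L <= glen c & cg_angle x (const_geodesics c) = 0.
Proof.
move=> ex; have harm0 n : 0 < (harmonic n : R) by exact: harmonic_gt0.
have [c cP] := choice (fun n => (exists2P _ _).1 (ex _ (harm0 n))).
have [|n m|g gL cg] := long_geodesics_closed c.
- by move=> n; have [] := cP n.
- rewrite -cg_angle_const; apply: le_lt_trans (cg_angle_triangle xr xp _ x _) _.
  by rewrite (cg_angle_sym xr xp _ x) ltrD//; [have [] := cP n|have [] := cP m].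
exists g => //; apply/eqP; rewrite eq_le.
have /andP[-> _] := cg_angle_itv xr xp x (const_geodesics g); rewrite andbT.
apply/ler_addgt0Pr => e e0; have e20 : 0 < e / 2 by rewrite divr_gt0.
have [n [ne cge]] := cg _ e20.
apply: le_trans (cg_angle_triangle xr xp _ (const_geodesics (c n)) _) _.
rewrite cg_angle_const add0r [leRHS]splitr lerD ?(ltW cge)//.
by have [_ xc] := cP n; rewrite ltW// (lt_trans xc ne).
Qed.

(** Two directions almost opposite to [x] are close to each other, because three angles add up to at
    most [2 * pi]; hence the chosen geodesics converge in direction. *)
Lemma long_opposite_closed (x : @cauchy_geodesics R M p) :
  (forall e, 0 < e -> exists2 c : geodesic p, L <= glen c &
     pi - e < cg_angle x (const_geodesics c)) ->
  exists2 c : geodesic p, L <= glen c & cg_angle x (const_geodesics c) = pi.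
Proof.
move=> ex; have harm0 n : 0 < (harmonic n : R) by exact: harmonic_gt0.
have [c cP] := choice (fun n => (exists2P _ _).1 (ex _ (harm0 n))).
have [|n m|g gL cg] := long_geodesics_closed c.
- by move=> n; have [] := cP n.
- have [_] := cP n; have [_] := cP m.
  have := cg_angle_sum3 xr xp x (const_geodesics (c n)) (const_geodesics (c m)).
  rewrite cg_angle_const (cg_angle_sym xr xp _ x).
  move: (cg_angle x _) (cg_angle x _) (gangle _ _) (harmonic n) (harmonic m).
  by move=> *; lra.
exists g => //; apply/eqP; rewrite eq_le.
have /andP[_ ->] := cg_angle_itv xr xp x (const_geodesics g); rewrite /=.
apply/ler_addgt0Pr => e e0; have e20 : 0 < e / 2 by rewrite divr_gt0.
have [n [ne cge]] := cg _ e20; have [_] := cP n.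
have := cg_angle_triangle xr xp x (const_geodesics g) (const_geodesics (c n)).
move: cge ne; rewrite cg_angle_const (gangle_sym xr xp g).
move: (cg_angle x _) (cg_angle x _) (gangle _ _) (harmonic n).
by move=> *; lra.
Qed.

End long_geodesics.

(** * The obtuse constant *)

Section obtuse.
Context {R : realType} {M : metricType R}.

Lemma obtuse_constant_near (e : R) : obtuse_constant M = (pi / 2)%:E -> 0 < e ->
  exists2 D : R, 0 < D &
    forall p q : M, p != q -> mdist p q < D -> pi / 2 - e < ob_pair p q.
Proof.
move=> obM e0; have : ((pi / 2 - e)%:E < obtuse_constant M)%E.
  by rewrite obM lte_fin; lra.
rewrite /obtuse_constant limf_einfE => /ereal_sup_gt[_ [V [D /= D0 DV] <-] eV].
exists D => // p q pq pqD; rewrite -lte_fin; apply: lt_le_trans eV _.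
by apply: ereal_inf_lbound; exists (p, q) => //; exact: DV.
Qed.

(* The junk values [sup set0 = 0] and [inf set0 = 0] are too small to matter:
   a large [ob_at p q] forces geodesics from [p] to [q] and to some far point. *)
Lemma ob_at_geodesic {k : R} {x0 : M} {r : R} (p q : M) (e : R) :
  comparison_ball k x0 r -> mdist x0 p < r / 2 ->
  e < pi -> pi / 2 - e < ob_at p q ->
  exists2 c : geodesic p, metric_radius M / 2 <= glen c &
    forall b : geodesic p, b (glen b) = q -> pi - e < gangle b c.
Proof.
move=> xr xp epi; rewrite /ob_at ltrBrDr; set S := [set _ | _ in _].
have -> : pi / 2 - e + pi / 2 = pi - e :> R by field.
move=> eS; have [supS|/sup_out S0] := pselect (has_sup S); last first.
  by move: eS; rewrite S0; lra.
(* The whole slack serves as error, so the value found still exceeds [pi - e]. *)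
have d0 : 0 < sup S - (pi - e) by lra.
have [v [xi [x far [c cx cxi]]]] := sup_adherent d0 supS.
rewrite subKr -cxi => <- ev; exists c.
  have c0 := glen_gt0 c; rewrite -(@geodesic_mdist0 _ _ _ c (glen c)) ?cx//.
  by rewrite lexx ltW.
move=> b bq; move: ev; rewrite /set_angle; set A := [set _ | _ in _] => eA.
have [infA|/inf_out A0] := pselect (has_inf A); last by move: eA; rewrite A0; lra.
apply: lt_le_trans eA _; apply: ge_inf; first by case: infA.
exists (dir b); first by exists b.
by rewrite (angle_class xr xp) cg_angle_const.
Qed.

End obtuse.

(** * Pieces of a geodesic *)

Section subgeodesics.
Context {R : realType} {M : metricType R} {p : M} (g : geodesic p) (t : R).

Lemma initial_subproof (tg : 0 < t <= glen g) (s u : R) :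
  0 <= s <= t -> 0 <= u <= t -> mdist (g s) (g u) = `|s - u|.
Proof.
move=> /andP[s0 st] /andP[u0 ut]; case/andP: tg => _ tg'.
by apply: gpath_isom; rewrite ?s0 ?u0 (le_trans _ tg').
Qed.

(** The same path stopped at [g t], so that its direction belongs to [dirs p (g t)]. *)
Definition initial_geodesic (tg : 0 < t <= glen g) : geodesic p :=
  @Geodesic _ _ p t g (proj1 (andP tg)) (gpath0 g) (initial_subproof tg).

Lemma backward_subproof (tg : 0 < t <= glen g) (s u : R) :
  0 <= s <= t -> 0 <= u <= t -> mdist (g (t - s)) (g (t - u)) = `|s - u|.
Proof.
move=> /andP[s0 st] /andP[u0 ut]; case/andP: tg => _ tg'.
rewrite gpath_isom; first by rewrite -normrN; congr `| _ |; ring.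
all: by apply/andP; split; lra.
Qed.

Lemma backward0 : g (t - 0) = g t.
Proof. by rewrite subr0. Qed.

Definition backward_geodesic (tg : 0 < t <= glen g) : geodesic (g t) :=
  @Geodesic _ _ (g t) t (fun s => g (t - s)) (proj1 (andP tg)) backward0
    (backward_subproof tg).

Lemma forward_subproof (t0 : 0 < t) (s u : R) :
  0 <= s <= glen g - t -> 0 <= u <= glen g - t ->
  mdist (g (t + s)) (g (t + u)) = `|s - u|.
Proof.
move=> /andP[s0 st] /andP[u0 ut].
rewrite gpath_isom; first by congr `| _ |; ring.
all: by apply/andP; split; lra.
Qed.

Lemma forward_gt0 : t < glen g -> 0 < glen g - t.
Proof. by rewrite subr_gt0. Qed.

Lemma forward0 : g (t + 0) = g t.
Proof. by rewrite addr0. Qed.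

Definition forward_geodesic (t0 : 0 < t) (tg : t < glen g) : geodesic (g t) :=
  @Geodesic _ _ (g t) (glen g - t) (fun s => g (t + s)) (forward_gt0 tg) forward0
    (forward_subproof t0).

Lemma backward_end (tg : 0 < t <= glen g) :
  backward_geodesic tg (glen (backward_geodesic tg)) = p.
Proof. by rewrite /= subrr gpath0. Qed.

Lemma gangle_initial (tg : 0 < t <= glen g) (c : geodesic p) :
  gangle (initial_geodesic tg) c = gangle g c.
Proof. by []. Qed.

(** Points at distance [s] on either side of [g t] are [2 * s] apart, so their comparison angle is
    exactly [pi]. *)
Lemma gangle_backward_forward {k : R} {x0 : M} {r : R} (tg : 0 < t <= glen g)
    (t0 : 0 < t) (tg' : t < glen g) :
  comparison_ball k x0 r -> mdist x0 (g t) < r / 2 ->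
  gangle (backward_geodesic tg) (forward_geodesic t0 tg') = pi.
Proof.
move=> xr xg; apply: (gangle_unique xr xg) => e D e0 D0.
pose s := Num.min D (Num.min t (glen g - t)) / 2.
have m0 : 0 < Num.min D (Num.min t (glen g - t)) by rewrite !lt_min D0 t0 subr_gt0.
have s0 : 0 < s by rewrite divr_gt0.
have : s < Num.min D (Num.min t (glen g - t)) by rewrite /s; lra.
rewrite !lt_min => /and3P[sD st sg].
exists s, s; rewrite s0 sD; split=> //=.
have -> : mdist (g (t - s)) (g (t + s)) = s + s.
  by rewrite geodesic_mdist; [ring|lra|lra|lra].
rewrite /cangle eqxx (_ : _ / _ = -1); last by field; rewrite gt_eqF.
by rewrite acosN1 subrr normr0.
Qed.

End subgeodesics.

(** * Long geodesics along or against a direction *)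

Section main.
Context {R : realType} {M : metricType R} {k : R} {p : M} {r : R}.
Context (pr : comparison_ball k p r) (M_compact : compact [set: M]).
Local Notation L := (metric_radius M / 2).
Context (L0 : 0 < L) (obM : obtuse_constant M = (pi / 2)%:E).

Let pp : mdist p p < r / 2.
Proof. by rewrite mdistxx divr_gt0// (comparison_ball_gt0 _ pr). Qed.

Definition far_behind (g : geodesic p) (e : R) : Prop :=
  exists2 c : geodesic p, L <= glen c & pi - e < gangle g c.

(** The bound [t < e] moves the base point to [p] as [e] shrinks, and [t < r / 2] keeps it where the
    comparison ball at [p] applies. *)
Definition far_ahead (g : geodesic p) (e : R) : Prop :=
  exists (t : R) (t0 : 0 < t) (tg : t < glen g) (c : geodesic (g t)),
    [/\ t < e, t < r / 2, L <= glen c & gangle (forward_geodesic g t t0 tg) c < e].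

(** The obtuse constant is applied to [p] and a nearby point [g t]; the maximum in [ob_pair] yields
    the two alternatives. *)
Lemma far_behind_or_ahead (g : geodesic p) (e : R) : 0 < e ->
  far_behind g e \/ far_ahead g e.
Proof.
move=> e0; pose e' := Num.min e (pi / 2).
have pi0 := pi_gt0 R.
have e'0 : 0 < e' by rewrite lt_min e0 divr_gt0.
have e'pi : e' < pi by have : e' <= pi / 2 by [rewrite ge_min lexx orbT]; lra.
have e'e : e' <= e by rewrite ge_min lexx.
have [D D0 DP] := obtuse_constant_near _ obM e'0.
have r0 := comparison_ball_gt0 _ pr; have g0 := glen_gt0 g.
pose m := Num.min (Num.min D e) (Num.min (glen g) (r / 2)).
have m0 : 0 < m by rewrite !lt_min D0 e0 g0 divr_gt0.
pose t := m / 2; have t0 : 0 < t by rewrite divr_gt0.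
have : t < m by rewrite /t; lra.
rewrite !lt_min -!andbA => /and4P[tD te tg tr].
have tg' : 0 < t <= glen g by rewrite t0 ltW.
have dt : mdist p (g t) = t by apply: geodesic_mdist0; rewrite !ltW.
have gtr : mdist p (g t) < r / 2 by rewrite dt.
have := DP _ _ (geodesic_neq g _ tg'); rewrite dt => /(_ tD).
rewrite /ob_pair lt_max => /orP[|] /ob_at_geodesic ob.
- have [c cL cb] := ob _ _ _ pr pp e'pi; left; exists c => //.
  have := cb (initial_geodesic g t tg') erefl; rewrite gangle_initial.
  by apply: le_lt_trans; rewrite lerD2l lerN2.
- have [c cL cb] := ob _ _ _ pr gtr e'pi; right; exists t, t0, tg, c; split => //.
  (* At [g t] the backward direction is at angle [pi] from the forward one and more than [pi - e']
     from [c], so less than [e'] is left between forward and [c]. *)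
  have := cb _ (backward_end g t tg').
  have := gangle_sum3 pr gtr (backward_geodesic g t tg') (forward_geodesic g t t0 tg) c.
  rewrite (gangle_backward_forward _ _ _ _ _ pr gtr).
  rewrite (gangle_sym pr gtr c).
  move: (gangle _ _) (gangle _ _); move=> a b *; lra.
Qed.

Lemma geodesic_side (g : geodesic p) : exists2 c : geodesic p, L <= glen c &
  gangle g c = 0 \/ gangle g c = pi.
Proof.
have [|||behind|ahead] := @forall_small_or R (far_behind g) (far_ahead g).
- by move=> e e' _ ee' [c cL ce]; exists c => //; apply: le_lt_trans ce; lra.
- move=> e e' _ ee' [t [t0 [tg [c [te tr cL ce]]]]].
  by exists t, t0, tg, c; split=> //; apply: lt_le_trans ee'.
- exact: far_behind_or_ahead.
- have [|c cL gc] := long_opposite_closed pr pp M_compact L0 (const_geodesics g).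
    by move=> e /behind[c cL ce]; exists c => //; rewrite cg_angle_const.
  by exists c => //; right; rewrite -cg_angle_const.
(* In the second alternative, base points [g (t n)] tend to [p] along [g], with errors
   [harmonic n]. *)
have harm0 n : 0 < (harmonic n : R) by exact: harmonic_gt0.
have [t tP] := choice (fun n => ahead _ (harm0 n)).
(* The geodesics start at varying points, so they are chosen as a dependent family once [t] is
   fixed. *)
have [c cP] : exists c : forall n, geodesic (g (t n)), forall n,
    exists (t0 : 0 < t n) (tg : t n < glen g),
    [/\ t n < harmonic n, t n < r / 2, L <= glen (c n) &
        gangle (forward_geodesic g (t n) t0 tg) (c n) < harmonic n].
  have h n : exists c : geodesic (g (t n)), exists (t0 : 0 < t n) (tg : t n < glen g),
    [/\ t n < harmonic n, t n < r / 2, L <= glen c &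
        gangle (forward_geodesic g (t n) t0 tg) c < harmonic n].
    by have [t0 [tg [c cP]]] := tP n; exists c, t0, tg.
  by exists (fun n => sval (cid (h n))) => n; exact: svalP (cid (h n)).
have [U UU sU] := subset_ultrafilter_nat.
have tE n s : 0 <= s -> s < glen g - t n -> mdist (g s) (g (t n + s)) = t n.
  have [t0 [tg _]] := cP n => s0 sg.
  by rewrite geodesic_mdist; [ring|lra|lra|lra].
have near_g s : 0 <= s -> s < glen g -> g (t n + s) @[n --> U] --> g s.
  move=> s0 sg V /nbhs_ballP[e /= e0 eV].
  have m0 : 0 < Num.min e (glen g - s) by rewrite lt_min e0 subr_gt0.
  have [N hN] := harmonic_lt _ m0; apply: sU; exists N => // n /= Nn; apply: eV.
  have := hN _ Nn; rewrite lt_min => /andP[he hg].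
  have [_ [_ [tn _ _ _]]] := cP n.
  by rewrite ballEmdist/= tE//; lra.
have [||h hL ch] := @geodesic_cvg _ _ _ U (fun n => g (t n)) p c L UU M_compact _ L0.
- have := near_g 0 (lexx _) (glen_gt0 g); rewrite gpath0.
  by under eq_fun do rewrite addr0.
- by move=> n; have [? [? []]] := cP n.
exists h; first by rewrite hL.
left; apply/eqP; rewrite eq_le; have /andP[-> _] := gangle_itv pr pp g h; rewrite andbT.
(* The bound to reach is [1 - cos 0], at one small length [s]. *)
apply: (gangle_le pr pp); first by rewrite lexx pi_ge0.
move=> D D0; have r0 := comparison_ball_gt0 _ pr; have g0 := glen_gt0 g.
pose m := Num.min D (Num.min L (Num.min (r / 2) (glen g))).
have m0 : 0 < m by rewrite !lt_min D0 L0 g0 divr_gt0.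
pose s := m / 2; have s0 : 0 < s by rewrite divr_gt0.
have : s < m by rewrite /s; lra.
rewrite !lt_min => /and4P[sD sL sr sg].
exists s, s; rewrite s0 sD; split=> //.
(* The hinge comparison at [g (t n)], between the rest of [g] and [c n], tends to the desired one at
   [p]. *)
have cv : cver k s s (mdist (g (t n + s)) (c n s)) @[n --> U] --> cver k s s (mdist (g s) (h s)).
  by apply: cver_cvg; apply: mdist_cvg (near_g _ (ltW s0) sg) (ch s).
have cosv : 1 - cos (harmonic n : R) @[n --> U] --> 1 - cos (0 : R).
  apply: cvgB; first exact: cvg_cst.
  apply: continuous_cvg; first exact: continuous_cos.
  by move=> V V0; apply: sU; exact: cvg_harmonic V V0.
apply: ler_cvg_to cv cosv _; apply: sU.
have gs0 : 0 < glen g - s by rewrite subr_gt0.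
have [N hN] := harmonic_lt _ gs0; exists N => // n /= Nn.
have [t0 [tg [tn tr cL gc]]] := cP n.
have xg : mdist p (g (t n)) < r / 2.
  by rewrite geodesic_mdist0// !ltW.
have fs : short r (forward_geodesic g (t n) t0 tg) s.
  by rewrite /short s0 sr andbT/=; have := hN n Nn; lra.
have cs : short r (c n) s by rewrite /short s0 sr (le_trans (ltW sL) cL).
apply: le_trans (gangle_hinge pr xg _ _ _ _ fs cs) _.
have hpi : (harmonic n : R) <= pi.
  apply: (@le_trans _ _ 1); last by have := pi_ge2 R; lra.
  by rewrite /harmonic invf_le1// ler1n.
rewrite lerD2l lerN2 leNgt ltr_cos ?in_itv//=; last 2 first.
- by rewrite hpi ltW.
- by have := gangle_itv pr xg (forward_geodesic g (t n) t0 tg) (c n).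
by rewrite -leNgt ltW.
Qed.

(** A direction is approximated by geodesic ones, for which the dichotomy is known; both
    alternatives are closed conditions. *)
Lemma direction_side (xi : direction p) : geodesic_towards L xi \/
  exists2 eta : direction p, angle xi eta = pi & geodesic_towards L eta.
Proof.
rewrite -(direction_repK xi); set x := direction_rep xi.
pose P e := exists2 c : geodesic p, L <= glen c & cg_angle x (const_geodesics c) < e.
pose Q e := exists2 c : geodesic p, L <= glen c & pi - e < cg_angle x (const_geodesics c).
have [||e e0|towards|opposite] := @forall_small_or R P Q.
- by move=> e e' _ ee' [c cL ce]; exists c => //; apply: lt_le_trans ee'.
- by move=> e e' _ ee' [c cL ce]; exists c => //; apply: le_lt_trans ce; rewrite lerD2l lerN2.
- have [n xn] := cg_angle_seq pr pp x e e0.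
  have [c cL [gc|gc]] := geodesic_side (x n).
    left; exists c; first exact: cL.
    have := cg_angle_triangle pr pp x (const_geodesics (x n)) (const_geodesics c).
    rewrite (cg_angle_const (x n)) gc addr0 => le_n.
    exact: le_lt_trans le_n xn.
  right; exists c; first exact: cL.
  (* As [c] is opposite to [x n], which is within [e] of [x], its angle with [x] exceeds
     [pi - e]. *)
  have := cg_angle_triangle pr pp (const_geodesics (x n)) x (const_geodesics c).
  rewrite (cg_angle_const (x n)) gc (cg_angle_sym pr pp _ x).
  by move: (cg_angle _ _) (cg_angle _ _) xn; move=> *; lra.
- have [c cL xc] := long_direction_closed pr pp M_compact L0 x towards.
  have e := eq_class_direction pr pp x (const_geodesics c) xc.
  by left; exists c; [exact: cL|exact: esym e].
- have [c cL xc] := long_opposite_closed pr pp M_compact L0 x opposite.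
  right; exists (dir c); last by exists c.
  exact: etrans (angle_class pr pp x (const_geodesics c)) xc.
Qed.

End main.

Theorem theorem1p5 (R : realType) (M : metricType R) (k : R)
  (M_alexandrov : alexandrov k M) (M_compact : compact [set: M])
  (M_ob : obtuse_constant M = (pi / 2)%:E) :
  ((metric_radius M / 2)%:E <= one_side_inj M)%E.
Proof.
(* A nonpositive bound is met because 0 belongs to the set whose supremum is [one_side_inj];
   otherwise limit geodesics of this length are nondegenerate. *)
have [L0|L0] := leP (metric_radius M / 2) 0.
  by apply: (@le_trans _ _ 0%E); rewrite ?lee_fin//; apply: ereal_sup_ubound; left.
apply: ereal_sup_ubound; right; exists (metric_radius M / 2) => //; split; first exact: ltW.
move=> p xi; have [r pr] := alexandrov_comparison_ball k M_alexandrov p.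
exact: (direction_side pr M_compact L0 M_ob).
Qed.
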